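(* Let $n\ge 1$ and $k\ge 0$. The coefficient of $x^k$ in the toric $g$-polynomial of the $n$-dimensional permutahedron is the number of parking trees on $n+1$ vertices that encode a $123$-avoiding parking function having exactly $k$ ascents.
   Context: $[n]=\{1,\ldots,n\}$. The $n$-dimensional permutahedron is the convex hull in $\mathbb{R}^{n+1}$ of the $(n+1)!$ vectors $(\pi_1,\ldots,\pi_{n+1})$, where $\pi$ ranges over all permutations of $[n+1]$. Toric $g$-polynomial: for an Eulerian poset $P$ with rank function $\rho$, minimum $\hat 0$ and maximum $\hat 1$, the polynomials $f(P,x)$ and $g(P,x)$ are defined recursively. For the one-element poset, $f=g=1$. If $\operatorname{rank} P=n+1>0$, then $f(P,x)=\sum_{y\in P\setminus\{\hat 1\}} g([\hat 0,y],x)(x-1)^{n-\rho(y)}$; writing $f(P,x)=h_0+h_1x+\cdots+h_nx^n$, one sets $g(P,x)=h_0+(h_1-h_0)x+\cdots+(h_m-h_{m-1})x^m$ with $m=\lfloor n/2\rfloor$. The toric $g$-polynomial of an $n$-dimensional polytope is that of its face lattice (all faces including the empty face and the polytope itself, ordered by inclusion, of rank $n+1$). A parking tree on $n+1$ vertices is a rooted plane tree (children of each vertex are linearly ordered left to right) whose vertices, respectively edges, are bijectively labeled with $[n+1]$, respectively $[n]$, such that (1) the label of each vertex is less than the label of any of its children, and (2) if $i<j$ are labels of edges connecting the same parent to different children, then the edge labeled $i$ lies to the left of the edge labeled $j$. The function $f:[n]\to[n]$ encoded by a parking tree is given by: $f(i)$ is the label of the parent vertex incident to the edge labeled $i$;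 this is always a parking function. For a function $f:[n]\to[n]$: $f$ is a parking function if $|f^{-1}([k])|\ge k$ for all $1\le k\le n$; $f$ is $123$-avoiding if there is no triple $1\le i_1<i_2<i_3\le n$ with $f(i_1)\le f(i_2)\le f(i_3)$; $f$ has an ascent at position $i$ if $1\le i\le n-1$ and $f(i)\le f(i+1)$. *)

(* Defs.v *)
From HB Require Import structures.
From mathcomp Require Import all_boot all_order all_algebra fingroup perm.
From mathcomp Require Import boolp classical_sets functions cardinality reals.

Set Implicit Arguments.
Unset Strict Implicit.
Unset Printing Implicit Defensive.

Import Order.TTheory GRing.Theory Num.Theory.

Local Open Scope ring_scope.

Section ToricPolynomials.
Context {d : Order.disp_t} (T : finTBPOrderType d).
Implicit Types x y z : T.

(* The rank of [x] is the largest length of a chain from the minimum to [x];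
   such a chain is recorded by its elements other than [x]. *)
Definition rank x : nat :=
  \max_(C : {set T} | [forall u in C, (u < x)%O] &&
                      [forall u in C, [forall v in C, (u >=< v)%O]]) #|C|.

(* For [h = h_0 + h_1 X + ...], the polynomial
   [h_0 + (h_1 - h_0) X + ... + (h_m - h_(m-1)) X^m]. *)
Definition gtrunc (m : nat) (h : {poly int}) : {poly int} :=
  \poly_(i < m.+1) (if i is j.+1 then h`_i - h`_j else h`_0).

(* [toric_g_at x] and [toric_f_at x] are the polynomials of the interval
   [\bot, x], in which every element has the same rank as in [T]. The recursion
   is on the rank; the equations of the recursive definition are [toric_f_atE]
   and [toric_g_atE] below. *)
Definition toric_f_from (G : T -> {poly int}) x : {poly int} :=
  if rank x is n.+1 then
    \sum_(y | (y < x)%O) G y * ('X - 1) ^+ (n - rank y)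
  else 1.

Definition toric_g_from (G : T -> {poly int}) x : {poly int} :=
  if rank x is n.+1 then gtrunc n./2 (toric_f_from G x) else 1.

Fixpoint toric_g_rec (m : nat) : T -> {poly int} :=
  if m is m'.+1 then toric_g_from (toric_g_rec m') else fun=> 1.

Definition toric_g_at x : {poly int} := toric_g_rec (rank x) x.
Definition toric_f_at x : {poly int} := toric_f_from toric_g_at x.

Definition toric_g : {poly int} := toric_g_at \top%O.

Lemma rank_lt x y : (x < y)%O -> (rank x < rank y)%N.
Proof.
move=> xy; rewrite /rank.
have [|C /andP[/forall_inP Cx /forall_inP Cc] ->] := @eq_bigmax_cond _
  (fun C : {set T} => [forall u in C, (u < x)%O] &&
     [forall u in C, [forall v in C, (u >=< v)%O]]) (fun C : {set T} => #|C|).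
  apply/card_gt0P; exists (finset.set0 : {set T}); rewrite unfold_in.
  by apply/andP; split; apply/forall_inP => u; rewrite inE.
have xC : x \notin C by apply/negP => /Cx; rewrite ltxx.
have -> : (#|C|.+1 = #|x |: C|)%N by rewrite cardsU1 xC.
apply: (leq_bigmax_cond (F := fun C : {set T} => #|C|)).
apply/andP; split; apply/forall_inP => u.
  by rewrite !inE => /predU1P[->//|/Cx /lt_trans]; apply.
rewrite !inE => uC; apply/forall_inP => v; rewrite !inE => vC.
case/predU1P: uC => [->|uC]; case/predU1P: vC => [->|vC].
- exact: comparablexx.
- by rewrite comparable_sym; apply/lt_comparable/Cx.
- exact/lt_comparable/Cx.
- by have /forall_inP := Cc _ uC; apply.
Qed.

Lemma toric_g_from_ext (G H : T -> {poly int}) x :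
  (forall y, (y < x)%O -> G y = H y) -> toric_g_from G x = toric_g_from H x.
Proof.
move=> GH; rewrite /toric_g_from; case E: (rank x) => [//|n].
congr (gtrunc _ _); rewrite /toric_f_from E.
by apply: eq_bigr => y yx; rewrite GH.
Qed.

Lemma toric_g_recE m x : (rank x <= m)%N -> toric_g_rec m x = toric_g_at x.
Proof.
rewrite /toric_g_at; have [k] := ubnP (rank x).
elim: k m x => // k IHk m x xk xm; case: m xm => [|m] xm.
  by move: xm; rewrite leqn0 => /eqP ->.
case E: (rank x) => [|r] /=; first by rewrite /toric_g_from E.
apply: toric_g_from_ext => y /rank_lt; rewrite E ltnS => yr.
have yk : (rank y < k)%N by rewrite E ltnS in xk; exact: leq_ltn_trans xk.
rewrite [LHS]IHk //; last by apply: leq_trans yr _; rewrite -ltnS -E.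
by rewrite [RHS]IHk.
Qed.

Lemma toric_g_at_from x : toric_g_at x = toric_g_from toric_g_at x.
Proof.
rewrite {1}/toric_g_at; case E: (rank x) => [|r] /=.
  by rewrite /toric_g_from E.
apply: toric_g_from_ext => y /rank_lt yx.
by apply: toric_g_recE; rewrite -ltnS -E.
Qed.

Lemma toric_g_at0 x : rank x = 0%N -> toric_g_at x = 1.
Proof. by move=> x0; rewrite /toric_g_at x0. Qed.

Lemma toric_f_atE x n : rank x = n.+1 ->
  toric_f_at x =
  \sum_(y | (y < x)%O) toric_g_at y * ('X - 1) ^+ (n - rank y).
Proof. by move=> xn; rewrite /toric_f_at /toric_f_from xn. Qed.

Lemma toric_g_atE x n : rank x = n.+1 ->
  toric_g_at x = gtrunc n./2 (toric_f_at x).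
Proof. by move=> xn; rewrite toric_g_at_from /toric_g_from xn. Qed.

End ToricPolynomials.

Section Polytopes.
Context {R : realType} {m : nat}.
Implicit Types (x a : 'rV[R]_m) (P F : set 'rV[R]_m).

Definition dot a x : R := \sum_j a 0 j * x 0 j.

Definition conv (I : finType) (v : I -> 'rV[R]_m) : set 'rV[R]_m :=
  [set x | exists l : I -> R,
     [/\ forall i, 0 <= l i, \sum_i l i = 1 & x = \sum_i l i *: v i]]%classic.

(* The choices [a = 0], [b = 0] and [a = 0], [b = 1] give [P] and the empty
   face. *)
Definition is_face P F : Prop :=
  exists (a : 'rV[R]_m) (b : R), (forall x, P x -> dot a x <= b) /\
    F = (P `&` [set x | dot a x = b])%classic.

End Polytopes.

Section FaceLattice.
Context {R : realType} {m : nat} {I : finType} (v : I -> 'rV[R]_m).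

Record face := Face {
  face_set : set 'rV[R]_m;
  _ : `[< is_face (conv v) face_set >] }.

HB.instance Definition _ := [isSub for face_set].
HB.instance Definition _ := [Choice of face by <:].

Definition face_vertices (F : face) : {set I} := [set i | `[< face_set F (v i) >]].

Lemma conv_vertex i : conv v (v i).
Proof.
exists (fun j => (j == i)%:R); split=> [j||]; first exact: ler0n.
  by rewrite (bigD1 i) //= eqxx big1 ?addr0 // => j /negPf ->.
rewrite (bigD1 i) //= eqxx scale1r big1 ?addr0 // => j /negPf ->.
by rewrite scale0r.
Qed.

Lemma dot_sum (a : 'rV[R]_m) (l : I -> R) :
  dot a (\sum_i l i *: v i) = \sum_i l i * dot a (v i).
Proof.
rewrite /dot; under eq_bigr => j _ do rewrite summxE mulr_sumr.
rewrite exchange_big; apply: eq_bigr => i _; rewrite mulr_sumr.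
by apply: eq_bigr => j _; rewrite mxE mulrCA.
Qed.

(* A face is the set of convex combinations of the [v i] it contains. *)
Lemma faceP (F : face) x : face_set F x <-> exists l : I -> R,
  [/\ forall i, 0 <= l i, \sum_i l i = 1, x = \sum_i l i *: v i &
      forall i, l i != 0 -> i \in face_vertices F].
Proof.
have /asboolP[a [b [le_b FE]]] := valP F.
have vF i : (i \in face_vertices F) = (dot a (v i) == b).
  rewrite inE FE; apply/asboolP/eqP => [[]//|ab]; split=> //.
  exact: conv_vertex.
rewrite FE; split=> [[[l [l0 l1 ->]] /= xb]|[l [l0 l1 -> lF]]].
  exists l; split=> // i li; rewrite vF.
  have s0 : \sum_i l i * (b - dot a (v i)) = 0.
    under eq_bigr => j _ do rewrite mulrBr.
    by rewrite sumrB -mulr_suml l1 mul1r -dot_sum xb subrr.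
  have t0 j : true -> 0 <= l j * (b - dot a (v j)).
    by rewrite mulr_ge0 // subr_ge0; apply/le_b/conv_vertex.
  have /eqP := psumr_eq0P t0 s0 (i := i) isT.
  by rewrite mulf_eq0 (negPf li) subr_eq0 eq_sym.
split; first by exists l.
rewrite /= dot_sum -[RHS]mul1r -l1 mulr_suml; apply: eq_bigr => i _.
have [->|/lF] := eqVneq (l i) 0; first by rewrite !mul0r.
by rewrite vF => /eqP ->.
Qed.

Definition face_spanned (A : {set I}) : option face :=
  insub [set x : 'rV[R]_m | exists l : I -> R,
    [/\ forall i, 0 <= l i, \sum_i l i = 1, x = \sum_i l i *: v i &
        forall i, l i != 0 -> i \in A]]%classic.

Lemma face_verticesK : pcancel face_vertices face_spanned.
Proof.
move=> F; rewrite /face_spanned.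
set S := (X in insub X); suff -> : S = face_set F by rewrite valK.
by apply/seteqP; split=> x /faceP.
Qed.

HB.instance Definition _ : isCountable face := PCanIsCountable face_verticesK.
HB.instance Definition _ : isFinite face := PCanIsFinite face_verticesK.

HB.instance Definition _ :=
  [SubChoice_isSubPOrder of face by <: with set_display].

Lemma face_leE (F G : face) :
  (F <= G)%O <-> (face_set F `<=` face_set G)%classic.
Proof. by rewrite leEsub -subsetEset. Qed.

Lemma dot0 (x : 'rV[R]_m) : dot 0 x = 0.
Proof. by rewrite /dot big1 // => j _; rewrite mxE mul0r. Qed.

Lemma is_face_set0 : `[< is_face (conv v) set0 >].
Proof.
apply/asboolP; exists 0, 1; split=> [x _|]; first by rewrite dot0.
apply/seteqP; split=> // x [_ /=] /eqP.
by rewrite dot0 eq_sym oner_eq0.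
Qed.

Lemma is_face_setT : `[< is_face (conv v) (conv v) >].
Proof.
apply/asboolP; exists 0, 0; split=> [x _|]; first by rewrite dot0.
by apply/seteqP; split=> [x vx|x []//]; split=> //=; rewrite dot0.
Qed.

Lemma face0_le (F : face) : (Face is_face_set0 <= F)%O.
Proof. by apply/face_leE. Qed.

Lemma le_faceT (F : face) : (F <= Face is_face_setT)%O.
Proof.
by apply/face_leE; have /asboolP[a [b [_ ->]]] := valP F; move=> x [].
Qed.

HB.instance Definition _ := Order.hasBottom.Build set_display face face0_le.
HB.instance Definition _ := Order.hasTop.Build set_display face le_faceT.

End FaceLattice.

Definition perm_vector (R : realType) (n : nat) (s : 'S_n) : 'rV[R]_n :=
  \row_i (s i).+1%:R.

Definition permutahedron_g (R : realType) (n : nat) : {poly int} :=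
  toric_g (face (@perm_vector R n.+1)).

Close Scope ring_scope.

(* Rooted plane trees with natural numbers on vertices and edges:
   [PNode v cs] has root label [v] and, from left to right, one pair
   (edge label, subtree) in [cs] for each child of the root. *)
Inductive ptree : Type := PNode of nat & seq (nat * ptree).

Definition root_label (t : ptree) : nat := let: PNode v _ := t in v.

Fixpoint vertex_labels (t : ptree) : seq nat :=
  let: PNode v cs := t in v :: flatten [seq vertex_labels c.2 | c <- cs].

(* The pairs (label of an edge, label of its parent vertex). *)
Fixpoint edge_parents (t : ptree) : seq (nat * nat) :=
  let: PNode v cs := t in
  flatten [seq (c.1, v) :: edge_parents c.2 | c <- cs].

Definition edge_labels (t : ptree) : seq nat := unzip1 (edge_parents t).

Fixpoint vertex_increasing (t : ptree) : bool :=
  let: PNode v cs := t in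
  all (fun c => (v < root_label c.2) && vertex_increasing c.2) cs.

Fixpoint edge_increasing (t : ptree) : bool :=
  let: PNode v cs := t in
  sorted ltn (unzip1 cs) && all (fun c => edge_increasing c.2) cs.

(* Labels are 1-based, as are the arguments and values of functions below. *)
Definition parking_tree (n : nat) (t : ptree) : bool :=
  [&& perm_eq (vertex_labels t) (iota 1 n.+1),
      perm_eq (edge_labels t) (iota 1 n),
      vertex_increasing t & edge_increasing t].

Definition encoded (t : ptree) (i : nat) : nat :=
  nth 0 (unzip2 (edge_parents t)) (index i (edge_labels t)).

(* The predicates below concern the restriction of [f] to [1, n]. *)
Definition parking_function (n : nat) (f : nat -> nat) : Prop :=
  (forall i, 1 <= i <= n -> 1 <= f i <= n) /\
  (forall k, 1 <= k <= n -> k <= count (fun i => 1 <= f i <= k) (iota 1 n)).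

Definition avoids123 (n : nat) (f : nat -> nat) : Prop :=
  ~ exists i1 i2 i3 : nat,
    [/\ 1 <= i1, i1 < i2, i2 < i3 & i3 <= n] /\ f i1 <= f i2 <= f i3.

Definition ascents (n : nat) (f : nat -> nat) : nat :=
  count (fun i => f i <= f i.+1) (iota 1 n.-1).

(* Main.v *)
(* For a simple polytope the defining recursion determines the toric g-polynomial
   linearly from the gamma-vector. Let [Gamma] be the linear functional sending
   [V^n] to the generating polynomial [c_n] of [123]-avoiding permutations by
   ascents, which is the toric g-polynomial of the [n]-cube; then [U^i V^j], where
   [U] stands for [V + (x - 1)], is sent to the generating polynomial of
   [123]-avoiding words with [i] letters occurring twice and [j] occurring once.
   The defining congruence of g modulo [x^(floor(n/2)+1)] reduces to the symmetry
   between [c_n(x)] and [x^n c_n(1/x)] together with [deg c_n <= n/2]; the latter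
   holds because ascents of such words cannot be adjacent.

   A face of the permutahedron is a linear ordering of the blocks of a set
   partition, and its h-polynomial is a product over the blocks of polynomials
   whose exponential generating function satisfies [E' = 1 + V E + U E^2]. Summing
   over all faces transforms [E] into [E / (1 - (x - 1) E)], which satisfies a
   Riccati equation of the same shape.

   A parking tree is the same as a function [f] on edges together with a bijection
   from edges to the vertices [2..n+1] under which every edge [i] is sent beyond
   [f i]. Reading [f] as a word and inserting its letters in decreasing order, a
   letter occurring once or twice multiplies the number of choices of such a
   bijection by [k] or [k (k - 1)], [k] being the number of unused vertices; these
   are the weights of the Riccati equation read backwards. *)

Require Import Defs.
From mathcomp Require Import all_boot all_order all_algebra.
From mathcomp Require Import ring lra zify.

Set Implicit Arguments.
Unset Strict Implicit.
Unset Printing Implicit Defensive.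

Import Order.TTheory GRing.Theory Num.Theory.

(** * Powers of the Eulerian exponential series *)

Local Open Scope ring_scope.

Section BinomialConvolution.
Variable A : comNzRingType.
Implicit Types f g : nat -> A.

Definition binconv f g m : A := \sum_(k < m.+1) 'C(m, k)%:R * f k * g (m - k)%N.

Lemma binconv0 f g : binconv f g 0 = f 0%N * g 0%N.
Proof. by rewrite /binconv big_ord1 bin0 mul1r. Qed.

Lemma binconvS f g m :
  binconv f g m.+1 = binconv (fun k => f k.+1) g m + binconv f (fun k => g k.+1) m.
Proof.
rewrite /binconv big_ord_recl bin0 subn0.
under eq_bigr => k _ do rewrite lift0 subSS binS natrD 2!mulrDl.
rewrite big_split /= addrCA addrC -addrA addrC -!addrA; congr (_ + _).
rewrite [RHS]big_ord_recl bin0 subn0 big_ord_recr /= bin_small // !mul0r addr0.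
rewrite addrC; congr (_ + _).
by apply: eq_bigr => k _; rewrite /bump leq0n add1n subnSK.
Qed.

Lemma binconvDl f f' g m : binconv (fun k => f k + f' k) g m = binconv f g m + binconv f' g m.
Proof. by rewrite /binconv -big_split; apply: eq_bigr => k _ /=; ring. Qed.

Lemma binconvDr f g g' m : binconv f (fun k => g k + g' k) m = binconv f g m + binconv f g' m.
Proof. by rewrite /binconv -big_split; apply: eq_bigr => k _ /=; ring. Qed.

Lemma binconvZl c f g m : binconv (fun k => c * f k) g m = c * binconv f g m.
Proof. by rewrite /binconv mulr_sumr; apply: eq_bigr => k _ /=; ring. Qed.

Lemma binconvZr c f g m : binconv f (fun k => c * g k) m = c * binconv f g m.
Proof. by rewrite /binconv mulr_sumr; apply: eq_bigr => k _ /=; ring. Qed.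

End BinomialConvolution.

Section RiccatiPowers.
Variable A : comNzRingType.

(* [epow U V m h] is the coefficient of [z^m / m!] in [E^h], where [E] is the
   series with [E' = 1 + V E + U E^2] and [E(0) = 0]. *)
Fixpoint epow (U V : A) (m h : nat) : A :=
  if m is m'.+1 then
    h%:R * (epow U V m' h.-1 + V * epow U V m' h + U * epow U V m' h.+1)
  else (h == 0%N)%:R.

Lemma epow_h0 U V m : epow U V m 0 = (m == 0%N)%:R.
Proof. by case: m => //= m; rewrite mul0r. Qed.

Lemma epowS1 U V m :
  epow U V m.+1 1 = epow U V m 0 + V * epow U V m 1 + U * epow U V m 2.
Proof. by rewrite /= mul1r. Qed.

Lemma epow_gt U V m h : (m < h)%N -> epow U V m h = 0.
Proof.
elim: m h => [|m IH] [|h] //= mh.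
by rewrite !IH ?mulr0 ?addr0 ?mulr0 //; lia.
Qed.

Section Shift.
Variables U V s : A.
Let V' := V + 2%:R * s.
Let U' := U + s * V + s ^+ 2.
Let mixed a b := binconv (fun k => epow U V k a) (fun k => epow U' V' k b).

Let mixedS m a b : mixed a b m.+1 =
  a%:R * (mixed a.-1 b m + V * mixed a b m + U * mixed a.+1 b m) +
  b%:R * (mixed a b.-1 m + V' * mixed a b m + U' * mixed a b.+1 m).
Proof.
rewrite /mixed binconvS /= binconvZl binconvZr 2!binconvDl 2!binconvDr.
by rewrite !binconvZl !binconvZr.
Qed.

(* With [E'] the series of the shifted parameters, [D = E' - E - s E E']
   satisfies [D' = (V + s + U E + U' E') D] and hence vanishes. *)
Let mixed_shift m a b :
  mixed a b.+1 m = mixed a.+1 b m + s * mixed a.+1 b.+1 m.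
Proof.
elim: m a b => [|m IH] a b.
  by rewrite /mixed !binconv0 /= !(mulr0, mul0r, add0r).
pose D a b := mixed a b.+1 m - mixed a.+1 b m - s * mixed a.+1 b.+1 m.
have D0 i j : D i j = 0 by rewrite /D IH; ring.
apply/eqP; rewrite -subr_eq0; apply/eqP.
(* [D a b] is a coefficient of E^a E'^b times the difference series; this is the product rule for
   its derivative. *)
transitivity (a%:R * (D a.-1 b + V * D a b + U * D a.+1 b) +
  b%:R * (D a b.-1 + V' * D a b + U' * D a b.+1) +
  ((V + s) * D a b + U * D a.+1 b + U' * D a b.+1)); last first.
  by rewrite !D0; ring.
rewrite !mixedS /D /V' /U'.
by case: a => [|a]; case: b => [|b] /=; rewrite -?natr1; ring.
Qed.

(** At a = b = 0, [mixed_shift] says that the shifted series is E / (1 - s E): a Riccati equation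
    keeps its shape under such a Möbius substitution. *)
Lemma epow_shift m : epow U' V' m 1 = epow U V m 1 +
  s * binconv (fun k => epow U V k 1) (fun k => epow U' V' k 1) m.
Proof.
have := mixed_shift m 0 0; rewrite /mixed.
have -> : binconv (fun k => epow U V k 0) (fun k => epow U' V' k 1) m = epow U' V' m 1.
  rewrite /binconv big_ord_recl bin0 subn0 epow_h0 !mul1r big1 ?addr0 // => k _.
  by rewrite epow_h0 mulr0 mul0r.
have -> // : binconv (fun k => epow U V k 1) (fun k => epow U' V' k 0) m = epow U V m 1.
rewrite /binconv big_ord_recr binn subnn epow_h0 /= mul1r mulr1 big1 ?add0r // => k _.
by rewrite epow_h0 subn_eq0 leqNgt ltn_ord mulr0.
Qed.

End Shift.
End RiccatiPowers.

(** * Weighted homogeneity, Motzkin walks, umbral functionals and reversal of polynomials *)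

Section Homogeneous.
Variables (A : comNzRingType) (U V : A).

(* [homog d p]: [p] is a polynomial in [U] and [V] with natural coefficients,
   homogeneous of degree [d] for the weights [2] of [U] and [1] of [V]. *)
Inductive homog : nat -> A -> Prop :=
| homog0 d : homog d 0
| homog1 : homog 0 1
| homogD d p q : homog d p -> homog d q -> homog d (p + q)
| homogU d p : homog d p -> homog d.+2 (U * p)
| homogV d p : homog d p -> homog d.+1 (V * p).

Lemma homogMn d p n : homog d p -> homog d (n%:R * p).
Proof.
move=> hp; elim: n => [|n IH]; first by rewrite mul0r; apply: homog0.
by rewrite -natr1 mulrDl mul1r; apply: homogD.
Qed.

Lemma homogM d d' p q : homog d p -> homog d' q -> homog (d + d') (p * q).
Proof.
move=> hp hq; elim: hp => {d p} [d||d p p' _ IHp _ IHp'|d p _ IH|d p _ IH].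
- by rewrite mul0r; apply: homog0.
- by rewrite mul1r add0n.
- by rewrite mulrDl; apply: homogD.
- by rewrite -mulrA 2!addSn; apply: homogU.
- by rewrite -mulrA addSn; apply: homogV.
Qed.

(** The three terms of the recursion lower m - h by 0, 1 and 2, the weights of 1, [V] and [U].
    Truncated subtraction does no harm, as [epow] vanishes for m < h. *)
Lemma homog_epow m h : homog (m - h) (epow U V m h).
Proof.
elim: m h => [|m IH] h /=.
  by case: h => [|h]; [apply: homog1 | apply: homog0].
case: h => [|h]; first by rewrite mul0r; apply: homog0.
have [mh|hm] := ltnP m h.
  have e0 k : (h <= k)%N -> epow U V m k = 0.
    by move=> hk; rewrite epow_gt // (leq_trans mh).
  by rewrite !e0 ?leqnn ?leqW // !mulr0 !addr0 mulr0; apply: homog0.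
apply: homogMn => /=; apply: homogD; first apply: homogD.
- by rewrite subSS.
- have [->|hm'] := eqVneq h m; first by rewrite epow_gt // mulr0; apply: homog0.
  have -> : (m.+1 - h.+1 = (m - h.+1).+1)%N by lia.
  exact: homogV.
- have [hm'|hm'] := leqP m h.+1; first by rewrite epow_gt // mulr0; apply: homog0.
  have -> : (m.+1 - h.+1 = (m - h.+2).+2)%N by lia.
  exact: homogU.
Qed.

End Homogeneous.

Section Walks.
Variable A : comNzRingType.

(* Weighted Motzkin walks with [n] steps from height [a] to [0]: the weight of
   an up step is [1], of a level step [alpha], of a down step [lambda]. *)
Fixpoint walk (alpha lambda : A) (n a : nat) : A :=
  if n is n'.+1 then
    walk alpha lambda n' a.+1 + alpha * walk alpha lambda n' a +
    lambda * (if a is a'.+1 then walk alpha lambda n' a' else 0)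
  else (a == 0%N)%:R.

End Walks.

Section Umbral.
Variable K : comNzRingType.
Implicit Types (c : nat -> K) (p q : {poly K}).

Definition umbral c p : K := \sum_(i < size p) p`_i * c i.

Lemma umbral_wide c p n : (size p <= n)%N -> umbral c p = \sum_(i < n) p`_i * c i.
Proof.
move=> pn; rewrite /umbral (big_ord_widen n (fun i => p`_i * c i) pn).
rewrite big_mkcond; apply: eq_bigr => i _; case: ltnP => // /(nth_default 0) ->.
by rewrite mul0r.
Qed.

Lemma umbralD c p q : umbral c (p + q) = umbral c p + umbral c q.
Proof.
pose n := maxn (size p) (size q).
rewrite (@umbral_wide _ (p + q) n) ?size_polyD //.
rewrite (@umbral_wide _ p n) ?leq_maxl // (@umbral_wide _ q n) ?leq_maxr //.
by rewrite -big_split; apply: eq_bigr => i _; rewrite coefD mulrDl.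
Qed.

Lemma umbralZ c a p : umbral c (a%:P * p) = a * umbral c p.
Proof.
rewrite mul_polyC (@umbral_wide _ _ (size p)) ?size_scale_leq // mulr_sumr.
by apply: eq_bigr => i _; rewrite coefZ mulrA.
Qed.

Lemma umbral0 c : umbral c 0 = 0.
Proof. by rewrite /umbral size_poly0 big_ord0. Qed.

Lemma umbral_sum c (I : Type) (r : seq I) (P : pred I) (F : I -> {poly K}) :
  umbral c (\sum_(i <- r | P i) F i) = \sum_(i <- r | P i) umbral c (F i).
Proof.
by elim/big_rec2: _ => [|i y1 y2 _ <-]; [exact: umbral0 | rewrite umbralD].
Qed.

Lemma umbral1 c : umbral c 1 = c 0%N.
Proof. by rewrite /umbral size_poly1 big_ord1 coef1 mul1r. Qed.

Lemma umbralX c p : umbral c ('X * p) = umbral (fun i => c i.+1) p.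
Proof.
rewrite (@umbral_wide c _ (size p).+1); last first.
  by rewrite (leq_trans (size_polyMleq _ _)) // size_polyX.
rewrite big_ord_recl coefXM mul0r add0r.
by apply: eq_bigr => i _; rewrite coefXM.
Qed.

Lemma eq_umbral c c' p : c =1 c' -> umbral c p = umbral c' p.
Proof. by move=> cc; apply: eq_bigr => i _; rewrite cc. Qed.

Lemma umbral_add c c' p : umbral (fun i => c i + c' i) p = umbral c p + umbral c' p.
Proof. by rewrite -big_split; apply: eq_bigr => i _; rewrite mulrDr. Qed.

Lemma umbral_scale a c p : umbral (fun i => a * c i) p = a * umbral c p.
Proof. by rewrite mulr_sumr; apply: eq_bigr => i _; rewrite mulrCA. Qed.

Lemma umbral_exchange (I : Type) (r : seq I) (P : pred I) (c : I -> nat -> K) p :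
  umbral (fun i => \sum_(j <- r | P j) c j i) p = \sum_(j <- r | P j) umbral (c j) p.
Proof.
by rewrite exchange_big; apply: eq_bigr => i _; rewrite mulr_sumr.
Qed.

End Umbral.

Section Reversal.
Variable K : nzRingType.
Implicit Types p q : {poly K}.

(* [q = X^n p(1/X)], for polynomials of degree at most [n]. *)
Definition reversal n p q : Prop :=
  [/\ (size p <= n.+1)%N, (size q <= n.+1)%N &
      forall i, (i <= n)%N -> q`_i = p`_(n - i)].

Lemma reversal0 n : reversal n 0 0.
Proof. by split=> [||i _]; rewrite ?size_poly0 ?coef0. Qed.

Lemma reversal1 : reversal 0 1 1.
Proof. by split=> [||[]//]; rewrite size_poly1. Qed.

Lemma reversalD n p q p' q' :
  reversal n p q -> reversal n p' q' -> reversal n (p + p') (q + q').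
Proof.
move=> [sp sq h] [sp' sq' h']; split=> [||i le_in].
- by rewrite (leq_trans (size_polyD _ _)) // geq_max sp.
- by rewrite (leq_trans (size_polyD _ _)) // geq_max sq.
- by rewrite !coefD h ?h'.
Qed.

Lemma reversalN n p q : reversal n p q -> reversal n (- p) (- q).
Proof. by case=> sp sq h; split=> [||i /h]; rewrite ?size_polyN // !coefN => ->. Qed.

Lemma size_XM p n : (size p <= n)%N -> (size ('X * p)%R <= n.+1)%N.
Proof.
move=> sp; rewrite (leq_trans (size_polyMleq _ _)) // size_polyX.
by rewrite add2n.
Qed.

Lemma reversal_Xr n p q : reversal n p q -> reversal n.+1 p ('X * q).
Proof.
case=> sp sq h; split=> [||i le_in]; [exact: leqW | exact: size_XM |].
rewrite coefXM; case: i le_in => [|i] le_in /=; last by rewrite h.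
by rewrite subn0 nth_default.
Qed.

Lemma reversal_Xl n p q : reversal n p q -> reversal n.+1 ('X * p) q.
Proof.
case=> sp sq h; split=> [||i]; [exact: size_XM | exact: leqW |].
rewrite leq_eqVlt => /predU1P[->|lt_in].
  by rewrite subnn coefXM nth_default.
by rewrite subSn // coefXM /= h.
Qed.

(** A small degree on one side becomes divisibility by a power of 'X on the other. *)
Lemma coef_reversal n k p q :
  reversal n p q -> (size p <= k.+1)%N -> forall i, (i + k < n)%N -> q`_i = 0.
Proof.
case=> sp sq h spk i ik; rewrite h; last by lia.
by rewrite nth_default // (leq_trans spk) //; lia.
Qed.

End Reversal.

(** * Words without weakly increasing triples, by ascents *)

Local Notation Kx := {poly int}.
Local Notation sX := ('X - 1 : Kx).

(* The state [(b, m)] of a reversed word records whether it has no ascent ([b])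
   and the length [m] of its longest strictly increasing prefix.  [insert1] and
   [insert2] sum over the insertions of one, respectively two, copies of a new
   smallest letter, an additional ascent having weight ['X]. *)
Definition insert1 (F : bool -> nat -> Kx) (b : bool) (m : nat) : Kx :=
  if b then F true m.+1 + 'X * \sum_(1 <= r < m.+1) F false r
  else F false m.+1 + F false m + 'X * \sum_(1 <= r < m) F false r.

Definition insert2 (F : bool -> nat -> Kx) (b : bool) (m : nat) : Kx :=
  if b then 'X * \sum_(1 <= r < m.+2) F false r
  else F false m.+1 + 'X * \sum_(1 <= r < m.+1) F false r.

(** Sums over n successive insertions of distinct, ever smaller letters into a word of the given
    state. From the state [(true, 0)] of the empty word this enumerates 123-avoiding permutations by
    ascents. *)
Fixpoint asc_poly (n : nat) : bool -> nat -> Kx :=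
  if n is n'.+1 then insert1 (asc_poly n') else fun _ _ => 1.

(* Under this linear relation, inserting two copies of a letter amounts to
   inserting one copy plus ['X - 1] times inserting none ([insert2E]); hence the
   sum over words depends only on the number of repeated letters. *)
Definition asc_compatible (F : bool -> nat -> Kx) :=
  forall m, F true m.+1 + sX * F true m = 'X * F false m.+1.

Lemma asc_poly_compatible n : asc_compatible (asc_poly n).
Proof.
elim: n => [|n IH] m /=; first by ring.
have e1 := IH m; have e2 := IH m.+1.
rewrite big_nat_recr //=; set S := \sum_(1 <= r < m.+1) _.
have -> : asc_poly n true m.+2 =
  'X * asc_poly n false m.+2 - sX * asc_poly n true m.+1 by rewrite -e2; ring.
ring.
Qed.

(** The hypothesis on the state excludes only [(false, 0)], which no word has: a word with an ascent
    is nonempty. *)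
Lemma insert2E F b m : asc_compatible F -> b || (0 < m)%N ->
  insert2 F b m = insert1 F b m + sX * F b m.
Proof.
move=> cF; case: b => /= [_|m0]; rewrite big_nat_recr //= mulrDr.
  by rewrite -cF; ring.
by ring.
Qed.

Lemma size_add_le (p q : Kx) n :
  (size p <= n)%N -> (size q <= n)%N -> (size (p + q)%R <= n)%N.
Proof. by move=> sp sq; rewrite (leq_trans (size_polyD _ _)) // geq_max sp. Qed.

(** The quantity n + m - ~~ b never grows under an insertion, and drops by at least two when the
    insertion creates an ascent, which pays for the factor 'X. *)
Lemma size_asc_poly n b m : b || (0 < m)%N ->
  (size (asc_poly n b m) <= ((n + m - ~~ b)./2).+1)%N.
Proof.
elim: n b m => [|n IH] b m bm /=; first by rewrite size_poly1.
have sumP j N : (forall r, (1 <= r < N)%N -> (n + r < j.*2.+3)%N) ->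
    (size ('X * \sum_(1 <= r < N) asc_poly n false r)%R <= j.+2)%N.
  move=> hj; apply: size_XM; rewrite big_nat.
  apply: (big_ind (fun p : Kx => (size p <= j.+1)%N)).
  - by rewrite size_poly0.
  - by move=> p q; apply: size_add_le.
  - move=> r rN; have /andP[r1 _] := rN; apply: leq_trans (IH _ _ _) _ => //.
    by have := hj r rN; lia.
case: b bm => /= bm.
  apply: size_add_le; first by apply: leq_trans (IH _ _ _) _ => //=; lia.
  have [->|m0] := posnP m; first by rewrite big_geq // mulr0 size_poly0.
  by apply: leq_trans (sumP (n + m - 1)./2 _ _) _ => [r|]; lia.
apply: size_add_le; first apply: size_add_le.
- by apply: leq_trans (IH _ _ _) _ => //=; lia.
- by apply: leq_trans (IH _ _ _) _ => //=; lia.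
- have [m1|m1] := leqP m 1; first by rewrite big_geq // mulr0 size_poly0.
  by apply: leq_trans (sumP (n + m - 2)./2 _ _) _ => [r|]; lia.
Qed.

(** In the basis of binomials in m the operator [insert1] becomes tridiagonal: Pascal's rule turns
    F(m + 1) + F(m) into an up step plus a level step of weight 2, and the hockey-stick identity
    turns the sum over r into a down step. *)
Lemma asc_poly_walk n m : asc_poly n false m.+1 =
  \sum_(a < m.+1) 'C(m, a)%:R * walk 2%:R 'X n a.
Proof.
elim: n m => [|n IH] m /=.
  rewrite big_ord_recl bin0 mulr1 big1 ?addr0 // => a _.
  by rewrite mulr0.
have hock p : \sum_(1 <= r < p.+1) asc_poly n false r =
    \sum_(a < p.+1) 'C(p, a.+1)%:R * walk 2%:R 'X n a.
  elim: p => [|p IHp].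
    by rewrite big_geq // big_ord1 bin_small ?mul0r.
  rewrite big_nat_recr //= IHp IH [in RHS]big_ord_recr /= bin_small // mul0r addr0.
  rewrite -big_split; apply: eq_bigr => a _.
  by rewrite /= binS natrD mulrDl.
have pas p : \sum_(a < p.+2) 'C(p.+1, a)%:R * walk 2%:R 'X n a =
   \sum_(a < p.+1) 'C(p, a)%:R * (walk 2%:R 'X n a + walk 2%:R 'X n a.+1).
  under [RHS]eq_bigr => a _ do rewrite mulrDr.
  rewrite big_ord_recl bin0 big_split /=.
  under eq_bigr => a _ do rewrite /bump leq0n add1n binS natrD mulrDl.
  rewrite big_split /= addrA; congr (_ + _).
  rewrite big_ord_recr /= bin_small // mul0r addr0 [RHS]big_ord_recl bin0.
  by congr (_ + _); apply: eq_bigr => a _; rewrite /bump leq0n add1n.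
rewrite !IH pas.
have -> : \sum_(1 <= r < m.+1) asc_poly n false r = \sum_(a < m.+1)
   'C(m, a)%:R * (if nat_of_ord a is a'.+1 then walk 2%:R 'X n a' else 0 : Kx) :> Kx.
  case: m => [|m]; first by rewrite big_geq // big_ord1 mulr0.
  rewrite hock big_ord_recr /= bin_small // mul0r addr0.
  rewrite [RHS]big_ord_recl mulr0 add0r.
  by apply: eq_bigr => a _; rewrite lift0.
rewrite mulr_sumr -!big_split; apply: eq_bigr => a _ /=.
by case: (nat_of_ord a) => [|k]; ring.
Qed.

(** * The functional computing toric g-polynomials *)

Definition Xdvd (k : nat) (p : Kx) : Prop := exists q, p = 'X^k * q.

Lemma XdvdD k p q : Xdvd k p -> Xdvd k q -> Xdvd k (p + q).
Proof. by move=> [p' ->] [q' ->]; exists (p' + q'); rewrite mulrDr. Qed.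

Lemma XdvdMl k p q : Xdvd k q -> Xdvd k (p * q).
Proof. by move=> [q' ->]; exists (p * q'); rewrite mulrCA. Qed.

Lemma XdvdX k p : Xdvd k p -> Xdvd k.+1 ('X * p).
Proof. by move=> [q ->]; exists q; rewrite mulrA -exprS. Qed.

Lemma Xdvd_le j k p : (j <= k)%N -> Xdvd k p -> Xdvd j p.
Proof.
by move=> jk [q ->]; exists ('X^(k - j) * q); rewrite mulrA -exprD subnKC.
Qed.

Lemma XdvdP k (p : Kx) : (forall i, (i < k)%N -> p`_i = 0) -> Xdvd k p.
Proof.
move=> pk; exists (drop_poly k p); rewrite -[LHS](poly_take_drop k) mulrC.
rewrite [take_poly k p](_ : _ = 0) ?add0r //; apply/polyP => i.
by rewrite coef_take_poly coef0; case: ltnP => // /pk.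
Qed.

(* The toric g-polynomial of the [n]-cube. *)
Definition cube_g (n : nat) : Kx := asc_poly n true 0.

(** This is the compatibility relation at m = 0, whose right-hand side is a walk starting at height
    0. *)
Lemma cube_gS n : cube_g n.+1 = 'X * walk 2%:R 'X n 0 - sX * cube_g n.
Proof.
have := asc_poly_compatible n 0; rewrite asc_poly_walk big_ord1 mul1r => <-.
by rewrite /cube_g /= big_geq // mulr0 addr0 addrK.
Qed.

(** The recurrence [cube_gS] after substituting 1/X and clearing denominators. *)
Fixpoint dual_cube_g (n : nat) : Kx :=
  if n is n'.+1 then sX * dual_cube_g n' + walk (2%:R * 'X) 'X n' 0 else 1.

(** A walk with l level and d down steps satisfies n + a = l + 2 d, so reversal turns X^d into X^(l
    + d): level steps acquire a factor 'X and down steps keep theirs. *)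
Lemma walk_reversal n a :
  reversal (n + a) (walk 2%:R 'X n a) (walk (2%:R * 'X : Kx) 'X n a).
Proof.
elim: n a => [|n IH] a /=.
  by case: a => [|a]; [exact: reversal1 | exact: reversal0].
apply: reversalD; first apply: reversalD.
- by rewrite addSnnS.
- move: (walk 2%:R 'X n a) (walk (2%:R * 'X) 'X n a) (IH a) => p q pq.
  by rewrite -mulrA !mulr_natl !mulr2n; apply: reversalD; apply: reversal_Xr.
- case: a => [|a]; first by rewrite !mulr0; apply: reversal0.
  by rewrite addSnnS !addnS; apply/reversal_Xl/reversal_Xr/IH.
Qed.

Lemma cube_g_reversal n : reversal n (cube_g n) (dual_cube_g n).
Proof.
elim: n => [|n IH]; first exact: reversal1.
have -> : cube_g n.+1 =
    cube_g n + - ('X * cube_g n) + 'X * walk 2%:R 'X n 0 by rewrite cube_gS; ring.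
have -> : dual_cube_g n.+1 =
    'X * dual_cube_g n + - dual_cube_g n + walk (2%:R * 'X) 'X n 0 by rewrite /=; ring.
apply: reversalD; first apply: reversalD.
- exact: reversal_Xr.
- exact/reversalN/reversal_Xl.
- by apply: reversal_Xl; rewrite -[X in reversal X]addn0; apply: walk_reversal.
Qed.

Lemma Xdvd_dual_cube_g n : Xdvd n./2 (dual_cube_g n).
Proof.
apply: XdvdP => i i_lt; apply: (coef_reversal (cube_g_reversal n) (k := n./2)).
  by apply: leq_trans (size_asc_poly _ _) _ => //=; rewrite addn0 subn0.
by lia.
Qed.

(* If the h-polynomial of a simple polytope is written as a polynomial in [V] and
   [U], standing for [p + q] and [p q] after homogenization in [p] and [q], its
   toric g-polynomial is obtained by substituting [U := V + (X - 1)] and mapping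
   [V^n] to that of the cube. *)
Definition toric_umbral : {poly Kx} -> Kx := umbral cube_g.

(* The value at [- sX] accounts for the empty face: the variable [hV'], of value
   [sX] there, replaces [hV] when summing h-polynomials over all faces. *)
Definition toric_umbral' (p : {poly Kx}) : Kx := toric_umbral p + sX * p.[- sX].

Local Notation hV := ('X : {poly Kx}).
Local Notation hU := ('X + sX%:P : {poly Kx}).
Local Notation hV' := ('X + 2%:R * sX%:P : {poly Kx}).
Local Notation hU' := ('X%:P * ('X + sX%:P) : {poly Kx}).

Lemma toric_umbralX p :
  toric_umbral (hV * p) = 'X * umbral (fun n => walk 2%:R 'X n 0) p - sX * toric_umbral p.
Proof.
rewrite /toric_umbral umbralX (eq_umbral _ cube_gS).
transitivity (umbral (fun n => 'X * walk 2%:R 'X n 0 + (- sX) * cube_g n) p).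
  by apply: eq_umbral => n; rewrite mulNr.
by rewrite umbral_add !umbral_scale mulNr.
Qed.

Lemma umbral_natZ c k a (p : {poly Kx}) :
  umbral c (k%:R * a%:P * p) = k%:R * a * umbral c p.
Proof. by rewrite -umbralZ polyCM polyC_natr. Qed.

(** Multiplication by [hV] prepends a step to the walk; the summand 2 sX of [hV'] raises the weight
    of level steps from 2 to 2 'X. *)
Lemma umbral_walk a n :
  umbral (fun n => walk 2%:R 'X n a) (hV' ^+ n) = walk (2%:R * 'X) 'X n a.
Proof.
elim: n a => [|n IH] a; first by rewrite expr0 umbral1.
rewrite exprS mulrDl umbralD umbralX /= umbral_natZ -!IH.
rewrite 2!umbral_add !umbral_scale.
case: a => [|a]; last by rewrite -IH; ring.
have -> : umbral (fun=> 0) (hV' ^+ n) = 0 :> Kx.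
  by rewrite /umbral big1 // => i _; rewrite mulr0.
ring.
Qed.

(** Both sides obey the recurrence of [dual_cube_g]: the term - sX of [toric_umbralX] and the 2 sX
    in [hV'] combine to sX, which is also the value of [hV'] at - sX. *)
Lemma toric_umbral'_exp n : toric_umbral' (hV' ^+ n) = 'X * dual_cube_g n.
Proof.
elim: n => [|n IH].
  by rewrite /toric_umbral' /toric_umbral expr0 umbral1 hornerC /=; ring.
rewrite /= mulrDr -umbral_walk mulrCA -IH /toric_umbral' exprS mulrDl.
rewrite /toric_umbral umbralD -!/(toric_umbral _) toric_umbralX.
rewrite /toric_umbral umbral_natZ -/(toric_umbral _) !hornerE.
ring.
Qed.

Lemma toric_umbral'D p q : toric_umbral' (p + q) = toric_umbral' p + toric_umbral' q.
Proof. by rewrite /toric_umbral' /toric_umbral umbralD hornerD; ring. Qed.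

Lemma toric_umbral'Z a p : toric_umbral' (a%:P * p) = a * toric_umbral' p.
Proof. by rewrite /toric_umbral' /toric_umbral umbralZ hornerCM; ring. Qed.

(** A factor [hU] of weight two is [hV], of weight one, plus sX, of degree one in 'X. The power of
    [hV] in the strengthened claim collects the factors already replaced. *)
Lemma size_toric_umbral d p : homog hU hV d p -> (size (toric_umbral p) <= d./2.+1)%N.
Proof.
move=> hp; suff H k : (size (toric_umbral (hV ^+ k * p)) <= (d + k)./2.+1)%N.
  by have := H 0; rewrite mul1r addn0.
elim: hp k => {d p} [d||d p q _ IHp _ IHq|d p _ IH|d p _ IH] k.
- by rewrite mulr0 /toric_umbral umbral0 size_poly0.
- rewrite mulr1 add0n /toric_umbral.
  have -> : umbral cube_g (hV ^+ k) = cube_g k.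
    elim: k cube_g => [|k IH] c; first by rewrite umbral1.
    by rewrite exprS umbralX IH.
  by apply: leq_trans (size_asc_poly _ _) _ => //=; rewrite addn0 subn0.
- by rewrite mulrDr /toric_umbral umbralD; apply: size_add_le; [exact: IHp|exact: IHq].
- have -> : hV ^+ k * (hU * p) = hV ^+ k.+1 * p + sX%:P * (hV ^+ k * p) by rewrite exprS; ring.
  rewrite /toric_umbral umbralD umbralZ -!/(toric_umbral _); apply: size_add_le.
    by apply: leq_trans (IH _) _; lia.
  rewrite mulrBl mul1r; apply: size_add_le.
    by apply: size_XM; apply: leq_trans (IH _) _; lia.
  by rewrite size_polyN; apply: leq_trans (IH _) _; lia.
- by rewrite mulrA -exprSr addSnnS.
Qed.

(** As [hU'] is 'X times ([hV'] - sX), each factor of weight two yields an 'X; the remaining powers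
    of [hV'] are handled by [toric_umbral'_exp]. *)
Lemma Xdvd_toric_umbral' d p : homog hU' hV' d p -> Xdvd d./2.+1 (toric_umbral' p).
Proof.
move=> hp; suff H k : Xdvd (d + k)./2.+1 (toric_umbral' (hV' ^+ k * p)).
  by have := H 0; rewrite mul1r addn0.
elim: hp k => {d p} [d||d p q _ IHp _ IHq|d p _ IH|d p _ IH] k.
- exists 0; rewrite mulr0 /toric_umbral' /toric_umbral umbral0 horner0; ring.
- by rewrite mulr1 toric_umbral'_exp add0n; apply/XdvdX/Xdvd_dual_cube_g.
- by rewrite mulrDr toric_umbral'D; apply: XdvdD; [exact: IHp | exact: IHq].
- have -> : hV' ^+ k * (hU' * p) =
    'X%:P * (hV' ^+ k.+1 * p + (- sX)%:P * (hV' ^+ k * p)) by rewrite exprS polyCN; ring.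
  rewrite toric_umbral'Z toric_umbral'D toric_umbral'Z.
  apply: XdvdX; apply: XdvdD; last apply: XdvdMl.
    by apply: Xdvd_le (IH _); lia.
  by apply: Xdvd_le (IH _); lia.
- by rewrite mulrA -exprSr addSnnS.
Qed.

(* [perm_h b] is the h-polynomial of the permutahedron with [b`!] vertices, and
   [perm_hsum b] the sum of those of its nonempty faces, weighted by
   [sX ^ codimension]. *)
Definition perm_h (b : nat) : {poly Kx} := epow hU hV b 1.
Definition perm_hsum (b : nat) : {poly Kx} := epow hU' hV' b 1.

Lemma perm_hsumE b : perm_hsum b = perm_h b + sX%:P * binconv perm_h perm_hsum b.
Proof.
rewrite /perm_hsum; have -> : hU' = hU + sX%:P * hV + sX%:P ^+ 2 by rewrite polyCB; ring.
exact: epow_shift.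
Qed.

(** At - sX the coefficient [hU'] vanishes and [hV'] becomes sX, so the Riccati equation degenerates
    to E' = 1 + sX E. *)
Lemma horner_perm_hsum b : (perm_hsum b.+1).[- sX] = sX ^+ b.
Proof.
elim: b => [|b IH].
  by rewrite /perm_hsum /= !hornerE /=; ring.
have -> : perm_hsum b.+2 = hV' * perm_hsum b.+1 + hU' * epow hU' hV' b.+1 2.
  by rewrite /perm_hsum epowS1 epow_h0 add0r.
move: (perm_hsum b.+1) (epow hU' hV' b.+1 2) IH => p q IH.
by rewrite hornerD 2!hornerM IH exprS !hornerE /=; ring.
Qed.

Lemma homog_perm_h b : homog hU hV b.-1 (perm_h b).
Proof. by have := homog_epow hU hV b 1; rewrite subn1. Qed.

Lemma homog_perm_hsum b : homog hU' hV' b.-1 (perm_hsum b).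
Proof. by have := homog_epow hU' hV' b 1; rewrite subn1. Qed.

(** * Ordered set partitions *)

Local Close Scope ring_scope.

Section OrderedSetPartitions.
Variable T : finType.
Implicit Types (A B X : {set T}) (L : seq {set T}).

Fixpoint is_osp A L : bool :=
  if L is X :: L' then [&& X != set0, X \subset A & is_osp (A :\: X) L']
  else A == set0.

Fixpoint osp_rec (m : nat) A : seq (seq {set T}) :=
  if A == set0 then [:: [::]] else
  if m is m'.+1 then
    [seq X :: L | X <- enum [set X in powerset A | X != set0],
                  L <- osp_rec m' (A :\: X)]
  else [::].

Definition osp A := osp_rec #|A| A.

Lemma card_osp_tail A X m : X != set0 -> X \subset A ->
  (#|A| <= m.+1)%N -> (#|A :\: X| <= m)%N.
Proof.
move=> X0 XA Am; rewrite cardsD (setIidPr XA).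
by move: X0; rewrite -card_gt0; lia.
Qed.

Lemma mem_osp_rec m A L : (#|A| <= m)%N -> (L \in osp_rec m A) = is_osp A L.
Proof.
elim: m A L => [|m IH] A L Am /=.
  move: Am; rewrite leqn0 cards_eq0 => /eqP ->; rewrite eqxx inE.
  by case: L => [|X L] /=; rewrite -size_eq0 ?eqxx // subset0; case: (X =P set0).
have [->|A0] := eqVneq A set0.
  by rewrite inE; case: L => [|X L] /=; rewrite -size_eq0 ?eqxx // subset0; case: (X =P set0).
apply/allpairsPdep/idP => [[X [L' [XA L'A ->]]] /=|].
  move: XA; rewrite mem_enum !inE => /andP[XA X0]; rewrite X0 XA -IH //.
  exact: (card_osp_tail X0 XA Am).
case: L => [|X L] /=; first by rewrite (negPf A0).
case/and3P=> X0 XA AL; exists X, L; split=> //.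
  by rewrite mem_enum !inE XA.
by rewrite IH // (card_osp_tail X0 XA Am).
Qed.

Lemma mem_osp A L : (L \in osp A) = is_osp A L.
Proof. exact: mem_osp_rec. Qed.

Lemma osp_rec_uniq m A : uniq (osp_rec m A).
Proof.
elim: m A => [|m IH] A /=; case: eqP => // _.
apply: allpairs_uniq_dep => [|X _|]; [exact: enum_uniq | exact: IH |].
by move=> [X L] [X' L'] _ _ /= [-> ->].
Qed.

Lemma osp_uniq A : uniq (osp A).
Proof. exact: osp_rec_uniq. Qed.

Lemma osp_recE m A : (#|A| <= m)%N -> perm_eq (osp_rec m A) (osp A).
Proof.
move=> Am; apply: uniq_perm; rewrite ?osp_rec_uniq //.
by move=> L; rewrite mem_osp mem_osp_rec.
Qed.

Lemma size_osp A L : is_osp A L -> (size L <= #|A|)%N.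
Proof.
elim: L A => [|X L IH] A //= /and3P[X0 XA /IH]; rewrite cardsD (setIidPr XA).
by move: X0 (subset_leq_card XA); rewrite -card_gt0; lia.
Qed.

Lemma sum_card_pred_osp A L : is_osp A L ->
  (\sum_(X <- L) #|X|.-1 = #|A| - size L)%N.
Proof.
elim: L A => [|X L IH] A /=; first by rewrite big_nil => /eqP ->; rewrite cards0.
case/and3P=> X0 XA /[dup] /size_osp le /IH; rewrite big_cons => ->.
move: le; rewrite cardsD (setIidPr XA).
by move: X0 (subset_leq_card XA); rewrite -card_gt0; lia.
Qed.

Lemma osp_neq0 A L X : is_osp A L -> X \in L -> X != set0.
Proof.
elim: L A => [|Y L IH] A //= /and3P[Y0 _ /IH H].
by rewrite inE => /predU1P[->|/H].
Qed.

Lemma osp_set0 L : is_osp set0 L -> L = [::].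
Proof. by case: L => //= X L; rewrite subset0; case: eqP. Qed.

Fixpoint refinements L : seq (seq {set T}) :=
  if L is B :: L' then [seq L1 ++ L2 | L1 <- osp B, L2 <- refinements L']
  else [:: [::]].

Lemma setDD_sub A B X : X \subset B -> A :\: X :\: (B :\: X) = A :\: B.
Proof.
move=> /subsetP XB; apply/setP => i; rewrite !inE negb_and negbK.
by case: (boolP (i \in X)) => [/XB ->|_] //=; rewrite andbF.
Qed.

Lemma osp_cat A B L1 L2 : B \subset A -> is_osp B L1 -> is_osp (A :\: B) L2 ->
  is_osp A (L1 ++ L2).
Proof.
elim: L1 A B => [|X L1 IH] A B BA /=.
  by move=> /eqP ->; rewrite setD0.
case/and3P=> -> XB L1X L2A /=; rewrite (subset_trans XB BA) /=.
apply: IH L1X _; first exact: setSD.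
by rewrite setDD_sub.
Qed.

Lemma osp_cat_inj B L1 L2 L1' L2' : is_osp B L1 -> is_osp B L1' ->
  L1 ++ L2 = L1' ++ L2' -> (L1, L2) = (L1', L2').
Proof.
elim: L1 B L1' => [|X L1 IH] B [|X' L1'] //=.
- by move=> _ _ ->.
- by move=> /eqP -> /and3P[X0]; rewrite subset0 (negPf X0).
- by move=> /and3P[X0 XB _] /eqP B0; rewrite B0 subset0 (negPf X0) in XB.
- move=> /and3P[_ _ h] /and3P[_ _ h'] [XX' e]; rewrite -XX' in h' *.
  by have [-> ->] := IH _ _ h h' e.
Qed.

Lemma refinements_uniq L : uniq (refinements L).
Proof.
elim: L => [|B L IH] //=; apply: allpairs_uniq => //; first exact: osp_uniq.
move=> [L1 L2] [L1' L2'] /allpairsP[[x y] [/= h _ [-> _]]].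
move=> /allpairsP[[x' y'] [/= h' _ [-> _]]].
by rewrite !mem_osp in h h'; apply: osp_cat_inj h h'.
Qed.

Lemma refinements_osp A L L' : is_osp A L -> L' \in refinements L -> is_osp A L'.
Proof.
elim: L A L' => [|B L IH] A L' /=; first by move=> A0; rewrite inE => /eqP ->.
case/and3P=> _ BA /IH h /allpairsP[[L1 L2] [/= L1B /h L2A ->]].
by rewrite mem_osp in L1B; apply: osp_cat BA L1B L2A.
Qed.

Lemma refinements_refl A L : is_osp A L -> L \in refinements L.
Proof.
elim: L A => [|B L IH] A //= /and3P[B0 _ /IH h].
apply/allpairsP; exists ([:: B], L); split=> //=.
by rewrite mem_osp /= B0 subxx setDv eqxx.
Qed.

Lemma size_refinements A L L' : is_osp A L -> L' \in refinements L ->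
  (size L <= size L')%N && ((size L == size L') ==> (L == L')).
Proof.
elim: L A L' => [|B L IH] A L' /=; first by move=> _; rewrite inE => /eqP ->.
case/and3P=> B0 BA /IH h /allpairsP[[L1 L2] [/= L1B /h/andP[le12 eq12] ->]].
rewrite mem_osp in L1B; case: L1 L1B => [|X L1] /=; first by rewrite (negPf B0).
case/and3P=> X0 XB XL1; rewrite size_cat ltnS.
rewrite (leq_trans le12) ?leq_addl //=; apply/implyP => /eqP [e].
have : size L1 = 0%N.
  by move: le12; rewrite e -{2}[size L2]add0n leq_add2r leqn0 => /eqP.
move/size0nil => L10; move: e XL1; rewrite L10 /= => /eqP e.
rewrite setD_eq0 => BX; rewrite (eqP (implyP eq12 e)).
by rewrite (_ : B = X) //; apply/eqP; rewrite eqEsubset BX.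
Qed.

(** Splits a singleton off the first block with at least two elements. This supplies the cover
    relations needed to compute ranks of faces. *)
Lemma refinements_split A L : is_osp A L -> (size L < #|A|)%N ->
  exists2 L', L' \in refinements L & size L' = (size L).+1.
Proof.
elim: L A => [|B L IH] A /=; first by move=> /eqP ->; rewrite cards0.
case/and3P=> B0 BA AL lt_A.
have [B1|B1] := eqVneq #|B| 1%N.
  have [|L' L'L e] := IH _ AL.
    by rewrite cardsD (setIidPr BA) B1; lia.
  exists (B :: L') => /=; last by rewrite e.
  apply/allpairsP; exists ([:: B], L').
  by split=> //=; rewrite mem_osp /= B0 subxx setDv eqxx.
have [i iB] := set0Pn _ B0.
exists ([set i] :: (B :\ i) :: L) => //=.
apply/allpairsP; exists ([:: [set i]; B :\ i], L); split=> //=; last first.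
  exact: refinements_refl AL.
rewrite mem_osp /= sub1set iB subxx setDv eqxx !andbT.
apply/andP; split; first by apply/set0Pn; exists i; rewrite inE.
rewrite -card_gt0; have := cardsD1 i B; rewrite iB.
by move: B0 B1; rewrite -card_gt0; lia.
Qed.

Definition pos L (i : T) : nat := find (fun X : {set T} => i \in X) L.

Lemma has_osp A L i : is_osp A L -> has (fun X : {set T} => i \in X) L = (i \in A).
Proof.
elim: L A => [|X L IH] A /=; first by move/eqP ->; rewrite inE.
by case/and3P=> _ /subsetP/(_ i) XA /IH ->; rewrite inE; case: (i \in X) XA => //= ->.
Qed.

Lemma pos_lt A L i : is_osp A L -> (pos L i < size L)%N = (i \in A).
Proof. by move=> AL; rewrite -has_find (has_osp _ AL). Qed.

Lemma pos_cat B L1 L2 i : is_osp B L1 ->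
  pos (L1 ++ L2) i = if i \in B then pos L1 i else (size L1 + pos L2 i)%N.
Proof. by move=> BL; rewrite /pos find_cat (has_osp _ BL). Qed.

(** If B is nonempty, the first block lies in B: an element of it outside B would have position 0,
    and no element of B could precede it. *)
Lemma osp_split A B L : is_osp A L -> B \subset A ->
  (forall i j, i \in B -> j \in A :\: B -> (pos L i < pos L j)%N) ->
  exists L1 L2, [/\ L = L1 ++ L2, is_osp B L1 & is_osp (A :\: B) L2].
Proof.
elim: L A B => [|X L IH] A B /=.
  move=> /eqP -> ; rewrite subset0 => /eqP -> _.
  by exists [::], [::]; split; rewrite //= ?setD0.
case/and3P=> X0 XA AL BA lt_pos.
have [->|B0] := eqVneq B set0.
  by exists [::], (X :: L); split; rewrite //= ?eqxx // setD0 X0 XA.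
have XB : X \subset B.
  apply/subsetP => i iX; apply: contraT => iB; have [j jB] := set0Pn _ B0.
  by have := lt_pos j i jB; rewrite !inE iB (subsetP XA) // iX ltn0 => /(_ isT).
have e : A :\: X :\: (B :\: X) = A :\: B.
  exact: setDD_sub.
have [||L1 [L2 [-> L1B L2A]]] := IH (A :\: X) (B :\: X) AL.
- exact: setSD.
- move=> i j; rewrite e => /setDP[iB iX] /[dup] /setDP[jA jB] /(lt_pos i j iB).
  by rewrite (negPf iX); case: ifP => // jX; rewrite (subsetP XB) in jB.
rewrite e in L2A; exists (X :: L1), L2; split=> //=.
by rewrite X0 XB.
Qed.

(** Together with [refinements_pos], this describes refinement by the strict orders on elements, the
    form in which inclusion of faces appears. The first block of [L] comes first in [L'], so
    [osp_split] cuts [L'] there. *)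
Lemma mem_refinements A L L' : is_osp A L -> is_osp A L' ->
  (forall i j, i \in A -> j \in A ->
     (pos L i < pos L j)%N -> (pos L' i < pos L' j)%N) ->
  L' \in refinements L.
Proof.
elim: L A L' => [|B L IH] A L' /=.
  by move=> /eqP -> /osp_set0 -> _; rewrite inE.
case/and3P=> B0 BA AL AL' lt_pos.
have [|L1 [L2 [e L1B L2A]]] := osp_split AL' BA.
  move=> i j iB /setDP[jA jB]; apply: lt_pos => //; first exact: subsetP iB.
  by rewrite iB (negPf jB).
rewrite e; apply/allpairsP; exists (L1, L2); split; rewrite ?mem_osp //=.
apply: (IH _ _ AL L2A) => i j /setDP[iA iB] /setDP[jA jB] ij.
have := lt_pos i j iA jA; rewrite e !(pos_cat _ _ L1B) (negPf iB) (negPf jB) /=.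
by rewrite ltn_add2l; apply.
Qed.

Lemma refinements_pos A L L' i j : is_osp A L -> L' \in refinements L ->
  i \in A -> j \in A -> (pos L i < pos L j)%N -> (pos L' i < pos L' j)%N.
Proof.
elim: L A L' => [|B L IH] A L' //=.
case/and3P=> B0 BA AL /allpairsP[[L1 L2] [/= L1B L2L ->]] iA jA.
rewrite mem_osp in L1B; rewrite !(pos_cat _ _ L1B).
case: ifP => iB; case: ifP => // jB.
  by move=> _; rewrite ltn_addr // (pos_lt _ L1B).
by rewrite ltnS ltn_add2l; apply: IH AL L2L _ _; rewrite inE ?iB ?jB.
Qed.

Fixpoint level_sets (f : T -> nat) (m len : nat) : seq {set T} :=
  if len is len'.+1 then
    let X := [set i | f i == m] in
    if X == set0 then level_sets f m.+1 len' else X :: level_sets f m.+1 len'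
  else [::].

Lemma level_setsP (f : T -> nat) m len : (forall i, f i < m + len)%N ->
  is_osp [set i | (m <= f i)%N] (level_sets f m len) /\
  forall i j, (m <= f i)%N -> (m <= f j)%N ->
    (pos (level_sets f m len) i < pos (level_sets f m len) j)%N = (f i < f j)%N.
Proof.
elim: len m => [|len IH] m lt_f /=.
  split=> [|i j fi]; last by have := lt_f i; lia.
  by apply/eqP/setP => i; rewrite !inE; have := lt_f i; lia.
have [|osp_m pos_m] := IH m.+1; first by move=> i; have := lt_f i; lia.
case: ifP => [/eqP X0|/negbT X0].
  have fm i : f i != m.
    by apply/negP => /eqP fi; have := in_set0 i; rewrite -X0 inE fi eqxx.
  split=> [|i j fi fj]; last by rewrite pos_m // ltn_neqAle eq_sym fm.
  rewrite (_ : [set i | _] = [set i | (m < f i)%N]) //; apply/setP => i.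
  by rewrite !inE [RHS]ltn_neqAle eq_sym fm.
split=> [|i j fi fj] /=.
  rewrite X0 /=; apply/andP; split.
    by apply/subsetP => i; rewrite !inE => /eqP ->.
  rewrite (_ : _ :\: _ = [set i | (m < f i)%N]) //; apply/setP => i.
  by rewrite !inE [RHS]ltn_neqAle eq_sym.
rewrite !inE; case: eqP => [->|/eqP fim]; case: eqP => [->|/eqP fjm].
- by rewrite !ltnn.
- by rewrite ltn0Sn ltn_neqAle eq_sym fjm fj.
- by rewrite ltn0; lia.
- by rewrite ltnS pos_m // ltn_neqAle eq_sym ?fim ?fjm.
Qed.

End OrderedSetPartitions.

Local Open Scope ring_scope.

Section OspSums.
Variables (T : finType) (A : comNzRingType).
Implicit Types (B X : {set T}) (L : seq {set T}) (w : nat -> A).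

Definition osp_sum w B : A := \sum_(L <- osp B) \prod_(X <- L) w #|X|.

Lemma osp_sum0 w : osp_sum w set0 = 1.
Proof. by rewrite /osp_sum /osp cards0 /= eqxx big_seq1 big_nil. Qed.

Lemma osp_sumE w B : B != set0 ->
  osp_sum w B = \sum_(X in powerset B | X != set0) w #|X| * osp_sum w (B :\: X).
Proof.
move=> B0; rewrite {1}/osp_sum /osp; have := card_gt0 B.
case e: #|B| => [|m]; first by rewrite (negPf B0).
move=> _ /=; rewrite (negPf B0) big_allpairs_dep big_enum_cond /=.
apply: eq_big => [X|X]; first by rewrite !inE andbT.
rewrite !inE andbT => /andP[XB X0]; rewrite /osp_sum mulr_sumr.
have p : perm_eq (osp_rec m (B :\: X)) (osp (B :\: X)).
  by apply/osp_recE/(card_osp_tail X0 XB); rewrite e.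
rewrite -(perm_big _ p).
by apply: eq_bigr => L _; rewrite big_cons.
Qed.

Lemma prod_osp_sum w L : \sum_(L' <- refinements L) \prod_(X <- L') w #|X| =
  \prod_(B <- L) osp_sum w B.
Proof.
elim: L => [|B L IH] /=; first by rewrite big_seq1 !big_nil.
rewrite big_allpairs_dep big_cons -IH /osp_sum mulr_suml.
apply: eq_bigr => L1 _; rewrite mulr_sumr.
by apply: eq_bigr => L2 _; rewrite big_cat.
Qed.

Lemma sum_subsets_card (f : nat -> A) B :
  \sum_(X in powerset B) f #|X| = \sum_(k < #|B|.+1) 'C(#|B|, k)%:R * f k.
Proof.
rewrite (partition_big (fun X : {set T} => inord #|X| : 'I_#|B|.+1) predT) //=.
apply: eq_bigr => k _; rewrite -[X in X%:R * _]cards_draws -sumr_const mulr_suml.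
apply: eq_big => [X|X].
  rewrite !inE; case: (boolP (X \subset B)) => //= XB.
  by rewrite -val_eqE /= inordK // ltnS subset_leq_card.
rewrite inE => /andP[XB /eqP <-]; rewrite inordK ?mul1r //.
by rewrite ltnS subset_leq_card.
Qed.

End OspSums.

(** In exponential generating functions, with s = sX, this is 1 / (1 - s E) = 1 + s E / (1 - s E),
    read off by removing the first block. *)
Lemma osp_sum_perm_h (T : finType) (B : {set T}) : B != set0 ->
  osp_sum (fun b => sX%:P * perm_h b) B = sX%:P * perm_hsum #|B|.
Proof.
have [m] := ubnP #|B|; elim: m B => // m IH B Bm B0.
rewrite osp_sumE // perm_hsumE.
have h0 : perm_h 0 = 0 by [].
transitivity (\sum_(X in powerset B) sX%:P * (perm_h #|X| *
    ((#|X| == #|B|)%:R + sX%:P * perm_hsum (#|B| - #|X|)))).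
  rewrite big_mkcondr; apply: eq_bigr => X; rewrite powersetE => XB.
  have [->|X0] := eqVneq X set0; first by rewrite cards0 h0 mul0r mulr0.
  rewrite -mulrA; congr (_ * (_ * _)).
  have cX : #|B :\: X| = (#|B| - #|X|)%N by rewrite cardsD (setIidPr XB).
  have [eX|neX] := eqVneq #|X| #|B|.
    have -> : B :\: X = set0.
      by apply/eqP; rewrite -cards_eq0 cX eX subnn.
    by rewrite osp_sum0 eX subnn /perm_hsum /= mulr0 addr0.
  rewrite add0r -cX; apply: IH.
    by rewrite cX; move: Bm X0; rewrite -card_gt0; move: (subset_leq_card XB); lia.
  by rewrite -card_gt0 cX; move: neX (subset_leq_card XB); lia.
rewrite (sum_subsets_card (fun k =>
  sX%:P * (perm_h k * ((k == #|B|)%:R + sX%:P * perm_hsum (#|B| - k))))).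
under eq_bigr => k _ do rewrite mulrCA mulrDr mulrDr.
rewrite -mulr_sumr big_split /= big_ord_recr /= binn eqxx mul1r mulr1.
rewrite big1 ?add0r => [|k _]; last first.
  by rewrite (ltn_eqF (ltn_ord k)) !mulr0.
congr (_ * (_ + _)); rewrite /binconv mulr_sumr; apply: eq_bigr => k _; ring.
Qed.

(** * Insertion of a smallest letter *)

Local Close Scope ring_scope.

Section Words.
Implicit Types (u w : seq nat).

Definition insert_at (T : Type) (r : nat) (x : T) (l : seq T) : seq T :=
  take r l ++ x :: drop r l.
Arguments insert_at : simpl never.

(* Words are read from right to left: weak descents and weakly decreasing
   triples stand for the ascents and the patterns [123] of the reversed word. *)
Fixpoint weak_descents u : nat :=
  if u is a :: u' then
    ((if u' is b :: _ then b <= a : nat else 0) + weak_descents u')%N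
  else 0.

(** A weakly decreasing triple starting at a is a weakly decreasing pair among the later letters not
    exceeding a. *)
Fixpoint avoids321 u : bool :=
  if u is a :: u' then sorted ltn [seq b <- u' | b <= a] && avoids321 u' else true.

Fixpoint incr_prefix u : nat :=
  if u is a :: u' then
    if u' is b :: _ then (if a < b then (incr_prefix u').+1 else 1) else 1
  else 0.

Lemma incr_prefix_gt0 a u : 0 < incr_prefix (a :: u).
Proof. by case: u => //= b u; case: ifP. Qed.

Lemma incr_prefix_size u : incr_prefix u <= size u.
Proof. by elim: u => //= a [|b u] //= IH; case: ifP => // _; rewrite ltnS. Qed.

Lemma take_incr_prefix r u : r <= incr_prefix u -> sorted ltn (take r u).
Proof.
elim: u r => [|a u IH] [|r] //=; case: u IH => [|b u] IH; first by case: r.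
case: ifP => [ab|_]; last by case: r.
by rewrite ltnS => /IH; case: r => //= r; rewrite ab.
Qed.

Lemma insert_atS (T : Type) r (x a : T) (u : seq T) :
  insert_at r.+1 x (a :: u) = a :: insert_at r x u.
Proof. by []. Qed.

Lemma insert_at0 (T : Type) (x : T) (u : seq T) : insert_at 0 x u = x :: u.
Proof. by rewrite /insert_at take0 drop0. Qed.

Lemma weak_descents2 a b u :
  weak_descents (a :: b :: u) = ((b <= a) + weak_descents (b :: u))%N.
Proof. by []. Qed.

Lemma incr_prefix2 a b u :
  incr_prefix (a :: b :: u) = if a < b then (incr_prefix (b :: u)).+1 else 1.
Proof. by []. Qed.

Lemma weak_descents_cons v u : all (ltn v) u ->
  weak_descents (v :: u) = weak_descents u /\ incr_prefix (v :: u) = (incr_prefix u).+1.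
Proof. by case: u => //= a u /andP[va _]; rewrite va leqNgt va. Qed.

(** The new letter forms a descent with its predecessor and none with its successor. At the end of
    the prefix this replaces the descent that ended the prefix, if there was one. *)
Lemma weak_descents_insert v u r : all (ltn v) u -> 0 < r <= incr_prefix u ->
  weak_descents (insert_at r v u) =
    (weak_descents u + ~~ ((r == incr_prefix u) && (0 < weak_descents u)))%N /\
  incr_prefix (insert_at r v u) = r.
Proof.
elim: u r => [|a u IH] [|r] //; rewrite insert_atS => /andP[va vu].
case: r => [_|r r_le].
  rewrite insert_at0 weak_descents2 incr_prefix2 (ltnW va) [a < v]ltnNge (ltnW va).
  have [-> _] := weak_descents_cons vu.
  case: u {IH} vu => [|b u] // _; rewrite weak_descents2 incr_prefix2.
  by have := incr_prefix_gt0 b u; case: (ltnP a b) => ab /=; lia.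
case: u IH vu r_le => [|b u] IH vu r_le //; rewrite insert_atS weak_descents2.
move: r_le; rewrite !incr_prefix2 weak_descents2; case: ifP => // ab r_le.
have [dE pE] := IH r.+1 vu r_le.
by rewrite insert_atS in dE pE; rewrite dE pE leqNgt ab !add0n eqSS.
Qed.

Lemma weak_descents_insert2 v u r : all (ltn v) u -> r <= incr_prefix u ->
  weak_descents (v :: insert_at r v u) =
    (weak_descents (insert_at r v u) + (r == 0))%N /\
  incr_prefix (v :: insert_at r v u) = r.+1.
Proof.
case: r => [|r] vu r_le.
  by rewrite insert_at0 /= leqnn ltnn addnC.
have [_ pE] := weak_descents_insert (r := r.+1) vu r_le; move: pE.
case: u vu r_le => // a u /andP[va _] _.
have {}va : v < a by [].
by rewrite insert_atS weak_descents2 incr_prefix2 va leqNgt va addn0 => ->.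
Qed.

Lemma sorted_cat_min v (p q : seq nat) : all (ltn v) p -> all (ltn v) q ->
  sorted ltn (p ++ v :: q) = (p == [::]) && sorted ltn q.
Proof.
case: p => [_ vq|a p /andP[va vp] vq] /=.
  by rewrite (path_sortedE ltn_trans) vq.
apply/negbTE/negP; rewrite (path_sortedE ltn_trans) => /andP[/allP/(_ v)].
by rewrite mem_cat inE eqxx orbT ltnNge (ltnW va) => /(_ isT).
Qed.

(** A strictly smallest letter can only be the last of a weakly decreasing triple, so the letters
    before it must increase strictly. *)
Lemma avoids321_insert v u r : all (ltn v) u -> r <= size u ->
  avoids321 (insert_at r v u) = avoids321 u && (r <= incr_prefix u).
Proof.
elim: u r => [|a u IH] [|r] // vau r_le.
  have /andP[va vu] := vau; rewrite insert_at0 /=.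
  have {}va : v < a by [].
  rewrite leqNgt va /= (@eq_in_filter _ _ pred0) ?filter_pred0 ?andbT // => b /(allP vu) vb.
  by rewrite leqNgt (vb : v < b).
have /andP[va vu] := vau; have {}va : v < a by [].
rewrite insert_atS /= IH //.
rewrite {1}/insert_at filter_cat /= (ltnW va) sorted_cat_min; last first.
- by rewrite all_filter; apply/allP => b /mem_drop/(allP vu) vb; apply/implyP.
- by rewrite all_filter; apply/allP => b /mem_take/(allP vu) vb; apply/implyP.
case: r r_le => [_|r r_le].
  by rewrite take0 drop0 eqxx /= andbT; case: (u) => [|b u'] //; case: ifP; rewrite andbT.
case: u IH vu vau r_le => [|b u] IH vu vau r_le //.
rewrite -[take _ _]/(b :: take r u) -[drop _ _]/(drop r u).
rewrite [X in _ && (r.+1 < X)]/=; case: (ltnP a b) => ab; last first.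
  by rewrite /= ab /= andbF.
rewrite ltnS; case: (boolP (r.+1 <= incr_prefix (b :: u))) => [le|_]; last by rewrite !andbF.
have := take_incr_prefix le; rewrite [take _ _]/= [sorted _ _]/=.
rewrite (path_sortedE ltn_trans) => /andP[/allP bt _].
have -> : [seq c <- b :: take r u | c <= a] = [::].
  rewrite /= leqNgt ab /= (@eq_in_filter _ _ pred0) ?filter_pred0 //= => c /bt bc.
  by rewrite leqNgt (ltn_trans ab bc).
have -> : [seq c <- b :: u | c <= a] = [seq c <- drop r u | c <= a].
  rewrite -[in LHS](cat_take_drop r u) /= leqNgt ab /= filter_cat.
  rewrite (@eq_in_filter _ _ pred0 (take r u)) ?filter_pred0 //= => c /bt bc.
  by rewrite leqNgt (ltn_trans ab bc).
by rewrite eqxx /= !andbT.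
Qed.

Lemma avoids321_cons v u : all (leq v) u -> count_mem v u <= 1 ->
  avoids321 (v :: u) = avoids321 u.
Proof.
move=> vu c1 /=; suff -> : [seq b <- u | b <= v] = nseq (count_mem v u) v.
  by case: (count_mem v u) c1 => [|[]].
rewrite -size_filter (@eq_in_filter _ (fun b => b <= v) (pred1 v)).
  by apply/all_pred1P; rewrite all_filter; apply/allP => b _; apply/implyP.
by move=> b /(allP vu) vb /=; rewrite eqn_leq vb andbT.
Qed.

Lemma avoids321_count a v u : avoids321 (a :: u) -> v <= a -> count_mem v u <= 1.
Proof.
case/andP=> srt _ va; have := sorted_uniq ltn_trans ltnn srt.
move/(count_uniq_mem v); rewrite count_filter.
have -> : count (predI (pred1 v) (fun b => b <= a)) u = count_mem v u.
  by apply: eq_count => b /=; case: eqP => // ->.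
by move=> ->; case: (_ \in _).
Qed.

End Words.

Local Open Scope ring_scope.

Section WordWeights.
Implicit Types (F : bool -> nat -> Kx) (u : seq nat).

Definition word_weight F u : Kx :=
  'X ^+ weak_descents u * F (weak_descents u == 0%N) (incr_prefix u).

Lemma sum_insert_at F v u : all (ltn v) u ->
  \sum_(0 <= r < (incr_prefix u).+1) word_weight F (insert_at r v u) =
  word_weight (insert1 F) u.
Proof.
move=> vu; rewrite big_ltn // insert_at0 {1}/word_weight.
have [-> ->] := weak_descents_cons vu.
(* In a word with a descent, insertion at the end of the prefix adds none and gives the summand
   [F false m] of [insert1]; every other r > 0 costs a factor 'X. *)
have ins r : (1 <= r < (incr_prefix u).+1)%N -> word_weight F (insert_at r v u) =
    'X ^+ weak_descents u *
    (if (r == incr_prefix u) && (0 < weak_descents u)%N then F false r else 'X * F false r).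
  rewrite ltnS => /(weak_descents_insert vu) [dE pE]; rewrite /word_weight dE pE.
  case: ifP => [/andP[_ d0]|_] /=; last by rewrite addn1 exprSr mulrA.
  by rewrite addn0 eqn0Ngt d0.
rewrite big_nat (eq_bigr _ ins) -big_nat -mulr_sumr -mulrDr /word_weight.
congr (_ * _); rewrite /insert1; have [_|d0] /= := posnP (weak_descents u).
  by rewrite mulr_sumr; under eq_bigr => r _ do rewrite andbF.
rewrite -addrA; congr (_ + _).
have p0 : (0 < incr_prefix u)%N by case: (u) d0 => // a u' _; apply: incr_prefix_gt0.
rewrite big_nat_recr //= eqxx addrC mulr_sumr; congr (_ + _).
by apply: eq_big_nat => r /andP[_ rm]; rewrite (ltn_eqF rm).
Qed.

Lemma sum_insert_at2 F v u : all (ltn v) u ->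
  \sum_(0 <= r < (incr_prefix u).+1) word_weight F (v :: insert_at r v u) =
  word_weight (insert2 F) u.
Proof.
move=> vu; rewrite big_ltn // insert_at0 {1}/word_weight.
have ins0 := weak_descents_insert2 vu (leq0n _); rewrite insert_at0 in ins0.
rewrite ins0.1 ins0.2 (weak_descents_cons vu).1 addn1 /=.
have ins r : (1 <= r < (incr_prefix u).+1)%N -> word_weight F (v :: insert_at r v u) =
    'X ^+ weak_descents u * (if (r == incr_prefix u) && (0 < weak_descents u)%N
                             then F false r.+1 else 'X * F false r.+1).
  rewrite ltnS => /[dup] /andP[r0 r_le] /(weak_descents_insert vu) [dE _].
  have [d2E p2E] := weak_descents_insert2 vu r_le.
  rewrite /word_weight d2E p2E dE (gtn_eqF r0) addn0.
  case: ifP => [/andP[_ d0]|_] /=; last by rewrite addn1 exprSr mulrA.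
  by rewrite addn0 eqn0Ngt d0.
rewrite big_nat (eq_bigr _ ins) -big_nat -mulr_sumr exprSr -mulrA -mulrDr /word_weight.
congr (_ * _); rewrite /insert2; have [_|d0] /= := posnP (weak_descents u).
  rewrite [in RHS]big_ltn // [in RHS]big_add1 /= mulrDr mulr_sumr; congr (_ + _).
  by under eq_bigr => r _ do rewrite andbF.
have p0 : (0 < incr_prefix u)%N by case: (u) d0 => // a u' _; apply: incr_prefix_gt0.
rewrite [in LHS]big_nat_recr //= eqxx addrA addrC; congr (_ + _).
rewrite [in RHS]big_ltn // [in RHS]big_add1 /= mulrDr mulr_sumr; congr (_ + _).
by apply: eq_big_nat => r /andP[_ rm]; rewrite (ltn_eqF rm).
Qed.

End WordWeights.

(** * Words of edges *)

Local Close Scope ring_scope.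

Section Biwords.
Variable n : nat.
Implicit Types (l w : seq (nat * nat)).

(* A letter [(a, b)] stands for an edge from the vertex [a] to its child [b]. *)
Definition biword v l : bool :=
  [&& all (fun p => [&& v <= p.1, p.1 < p.2 & p.2 <= n.+1]) l,
      uniq (unzip2 l) & avoids321 (unzip1 l)].

Definition unused v l : seq nat := [seq b <- iota v.+1 (n.+1 - v) | b \notin unzip2 l].

Definition ext1 v l :=
  [seq insert_at r (v, b) l | r <- iota 0 (incr_prefix (unzip1 l)).+1, b <- unused v l].

(** Of two copies of a smallest letter one must lead the word: any letter before both would complete
    a weakly decreasing triple. *)
Definition ext2 v l := [seq (v, b) :: w | w <- ext1 v l, b <- unused v w].

Definition extensions v l := l :: ext1 v l ++ ext2 v l.

Fixpoint biwords (j : nat) :=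
  if j is j'.+1 then [seq l' | l <- biwords j', l' <- extensions (n - j') l]
  else [:: [::]].

Lemma mem_unused v l b : (b \in unused v l) = [&& v < b, b <= n.+1 & b \notin unzip2 l].
Proof.
rewrite mem_filter mem_iota andbC -andbA; case: (ltnP v b) => //= vb.
by congr (_ && _); lia.
Qed.

Lemma unused_uniq v l : uniq (unused v l).
Proof. by rewrite filter_uniq ?iota_uniq. Qed.

(** Since all used labels exceed v, the number of choices depends only on the length of the word.
    This is what inserting letters in decreasing order achieves. *)
Lemma size_unused v l : uniq (unzip2 l) -> all (fun b => v < b <= n.+1) (unzip2 l) ->
  size (unused v l) = n.+1 - v - size l.
Proof.
move=> ul al; have := count_predC (mem (unzip2 l)) (iota v.+1 (n.+1 - v)).
rewrite size_iota -!size_filter -/(unused v l) => <-.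
suff /perm_size -> : perm_eq [seq b <- iota v.+1 (n.+1 - v) | mem (unzip2 l) b] (unzip2 l).
  by rewrite size_map addKn.
apply: uniq_perm => //; first by rewrite filter_uniq ?iota_uniq.
move=> b; rewrite mem_filter /= mem_iota; case: (boolP (b \in _)) => //= /(allP al).
lia.
Qed.

Lemma unzip1_insert r p l : unzip1 (insert_at r p l) = insert_at r p.1 (unzip1 l).
Proof. by rewrite /insert_at /unzip1 map_cat map_take /= map_drop. Qed.

Lemma perm_insert (T : eqType) r (x : T) (l : seq T) : perm_eq (insert_at r x l) (x :: l).
Proof. by rewrite /insert_at perm_catC /= perm_cons perm_catC cat_take_drop. Qed.

Lemma perm_unzip2_insert r p l :
  perm_eq (unzip2 (insert_at r p l)) (p.2 :: unzip2 l).
Proof. exact: (perm_map snd (perm_insert r p l)). Qed.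

Lemma biword_all v l : biword v.+1 l -> all (ltn v) (unzip1 l).
Proof. by case/and3P=> al _ _; rewrite all_map; apply: sub_all al => p /and3P[]. Qed.

Lemma biword_labels v l : biword v l -> all (fun b => v < b <= n.+1) (unzip2 l).
Proof.
case/and3P=> al _ _; rewrite all_map; apply: sub_all al => p /= /and3P[vp pp ->].
by rewrite (leq_ltn_trans vp pp).
Qed.

Lemma biword_leq v v' l : v' <= v -> biword v l -> biword v' l.
Proof.
move=> vv /and3P[al ul av]; apply/and3P; split=> //.
by apply: sub_all al => p /and3P[vp -> ->]; rewrite (leq_trans vv vp).
Qed.

Lemma biword_insert v l r b : biword v.+1 l -> r <= size l ->
  biword v (insert_at r (v, b) l) =
    (r <= incr_prefix (unzip1 l)) && (b \in unused v l).
Proof.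
move=> vl r_le; have [al ul avl] := and3P vl; have vu := biword_all vl.
rewrite /biword unzip1_insert /= avoids321_insert ?size_map // avl /=.
rewrite (perm_all _ (perm_insert r (v, b) l)) /= leqnn /=.
rewrite (perm_uniq (perm_unzip2_insert r (v, b) l)) /= ul andbT mem_unused.
have -> : all (fun p => [&& v <= p.1, p.1 < p.2 & p.2 <= n.+1]) l.
  by have /and3P[] := biword_leq (leqnSn v) vl.
by rewrite andbT -!andbA [RHS]andbC -!andbA.
Qed.

Lemma mem_ext1 v l l' : biword v.+1 l -> l' \in ext1 v l ->
  exists r b, [/\ r <= incr_prefix (unzip1 l), b \in unused v l, 
    l' = insert_at r (v, b) l & biword v l'].
Proof.
move=> vl /allpairsP[[r b] []]; rewrite mem_iota add0n ltnS => rl bl ->.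
exists r, b; split=> //; rewrite biword_insert //; first exact/andP.
by rewrite (leq_trans rl) // (leq_trans (incr_prefix_size _)) // size_map.
Qed.

Lemma filter_insert v l r b : biword v.+1 l ->
  [seq p <- insert_at r (v, b) l | v < p.1] = l.
Proof.
move=> /biword_all; rewrite all_map => al.
rewrite /insert_at filter_cat /= ltnn -filter_cat cat_take_drop.
exact/all_filterP.
Qed.

(** Filtering recovers [l] from its extension, so words with different origins stay distinct in
    [biwords]. *)
Lemma extensions_biword v l l' : biword v.+1 l -> l' \in extensions v l ->
  biword v l' /\ [seq p <- l' | v < p.1] = l.
Proof.
move=> vl; rewrite inE mem_cat => /or3P[/eqP ->||].
- split; first exact: biword_leq vl.
  by apply/all_filterP; have := biword_all vl; rewrite all_map.
- by move/(mem_ext1 vl) => [r [b [_ _ -> vl']]]; rewrite filter_insert.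
case/allpairsPdep=> w [c [/(mem_ext1 vl) [r [b [rl bl e vw]]] cw ->]].
have fw : [seq p <- w | v < p.1] = l by rewrite e filter_insert.
rewrite /= ltnn fw; split=> //; move: cw; rewrite mem_unused => /and3P[vc cn cw].
have [aw uw avw] := and3P vw; apply/and3P; split=> /=; last 1 first.
- rewrite [_ && _](_ : _ = avoids321 (v :: unzip1 w)) // avoids321_cons //.
    by rewrite all_map; apply: sub_all aw => p /and3P[].
  rewrite e unzip1_insert /= (permP (perm_insert _ _ _)) /= eqxx.
  rewrite -[leqRHS]addn0 leq_add2l leqn0 -leqn0 leqNgt -has_count; apply/hasPn.
  by move=> x /(allP (biword_all vl)) /= vx; rewrite (gtn_eqF vx).
- by rewrite leqnn vc cn.
- by rewrite cw.
Qed.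

Lemma ext_split v w : biword v w -> count_mem v (unzip1 w) <= 1 ->
  exists2 l, biword v.+1 l & w \in l :: ext1 v l.
Proof.
move=> vw c1; have [aw uw avw] := and3P vw.
have lt_v x : x \in unzip1 w -> (v < x) = (x != v).
  case/mapP=> p /(allP aw)/and3P[vp _ _] ->.
  by rewrite ltn_neqAle vp andbT eq_sym.
have [vin|vnot] := boolP (v \in unzip1 w); last first.
  exists w; last exact: mem_head.
  apply/and3P; split=> //; apply/allP => p pw; have /and3P[_ -> ->] := allP aw p pw.
  by rewrite lt_v ?map_f // !andbT; apply: contraNneq vnot => <-; apply: map_f.
have /mapP[[v' b] vb e] := vin; rewrite /= in e.
case/splitPr: vb aw uw avw c1 lt_v vw {vin}; rewrite -{}e {v'} => p q aw uw avw c1 lt_v vw.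
have wE : insert_at (size p) (v, b) (p ++ q) = p ++ (v, b) :: q.
  by rewrite /insert_at take_size_cat // drop_size_cat.
have not_v x : x \in p ++ q -> x.1 != v.
  move=> xpq; apply/negP => /eqP xv; move: c1.
  rewrite -wE unzip1_insert (permP (perm_insert _ _ _)) /= eqxx add1n ltnS leqNgt.
  by rewrite -has_count => /hasPn/(_ x.1); rewrite map_f // xv /= eqxx => /(_ isT).
have gt_v : all (fun x : nat * nat => [&& v < x.1, x.1 < x.2 & x.2 <= n.+1]) (p ++ q).
  apply/allP => x xpq; have xw : x \in p ++ (v, b) :: q.
    by move: xpq; rewrite !mem_cat inE => /orP[] ->; rewrite ?orbT.
  have /and3P[_ -> ->] := allP aw x xw.
  by rewrite !andbT lt_v ?not_v // map_f.
have vpq : biword v.+1 (p ++ q).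
  apply/and3P; split=> //.
    by move: uw; rewrite -wE (perm_uniq (perm_unzip2_insert _ _ _)) => /andP[].
  move: avw; rewrite -wE unzip1_insert /= avoids321_insert ?size_map ?size_cat ?leq_addr //.
    by case/andP.
  by rewrite all_map; apply: sub_all gt_v => x /and3P[].
exists (p ++ q) => //; rewrite inE; apply/orP; right.
have := biword_insert b vpq (_ : size p <= size (p ++ q)).
rewrite size_cat leq_addr wE vw => /(_ isT)/esym/andP[rl bl].
by rewrite -wE; apply: allpairs_f => //; rewrite mem_iota /= add0n ltnS.
Qed.

(** After the first letter, v occurs at most once, because the later letters not exceeding the first
    increase strictly. A leading v can therefore be removed before applying [ext_split]. *)
Lemma extensions_exists v l' : biword v l' ->
  exists2 l, biword v.+1 l & l' \in extensions v l.
Proof.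
case: l' => [|[a b] w] vl'; first by exists [::]; rewrite ?mem_head.
have [al ul avl] := and3P vl'; have /andP[/= /and3P[va ab bn] aw] := al.
have c1 : count_mem v (unzip1 w) <= 1 by exact: avoids321_count avl va.
have [av|av] := eqVneq a v; last first.
  have [|l vl] := ext_split vl'; first by rewrite /= (negPf av).
  by rewrite inE => h; exists l; rewrite // inE mem_cat orbA h.
have vw : biword v w.
  by case/andP: ul => _ uw; case/andP: avl => _ avw; apply/and3P.
have [l vl wl] := ext_split vw c1; exists l => //.
have bw : b \in unused v w by rewrite mem_unused bn -{1}av ab; case/andP: ul.
rewrite av inE mem_cat; apply/or3P; move: wl; rewrite inE => /predU1P[wl|wl].
  rewrite wl in bw *; apply: Or32; rewrite -[_ :: _](insert_at0 (v, b) l).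
  by apply: allpairs_f => //; rewrite mem_iota.
by apply: Or33; apply/allpairsPdep; exists w, b.
Qed.

Lemma ext1_uniq v l : biword v.+1 l -> uniq (ext1 v l).
Proof.
move=> vl; apply: allpairs_uniq => [||[r b] [r' b']]; rewrite ?iota_uniq ?unused_uniq //.
move=> /allpairsP[[x y] [xr _ [-> _]]] /allpairsP[[x' y'] [xr' _ [-> _]]].
rewrite [fst _]/= in xr; rewrite [fst _]/= in xr'.
have idx s c : s \in iota 0 (incr_prefix (unzip1 l)).+1 ->
    index v (unzip1 (insert_at s (v, c) l)) = s.
  rewrite mem_iota /= add0n ltnS => sl; rewrite unzip1_insert /insert_at index_cat.
  have -> : (v \in take s (unzip1 l)) = false.
    by apply/negP => /mem_take /(allP (biword_all vl)) /=; rewrite ltnn.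
  by rewrite /= eqxx addn0 size_takel // (leq_trans sl) // incr_prefix_size.
move=> /= e; have := idx x b xr; rewrite e idx // => xx.
rewrite -xx in e *; congr (_, _); move/eqP: e.
by rewrite /insert_at eqseq_cat // eqxx /= => /eqP [->].
Qed.

Lemma extensions_uniq v l : biword v.+1 l -> uniq (extensions v l).
Proof.
move=> vl; have s1 w : w \in ext1 v l -> size w = (size l).+1.
  by move=> /(mem_ext1 vl) [r [b [_ _ -> _]]]; rewrite (perm_size (perm_insert _ _ _)).
have s2 w : w \in ext2 v l -> size w = (size l).+2.
  by case/allpairsPdep=> w' [b [/s1 e _ ->]]; rewrite /= e.
rewrite /extensions /= mem_cat cat_uniq ext1_uniq //=; apply/and3P; split.
- by apply/norP; split; [apply/negP => /s1 | apply/negP => /s2]; lia.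
- by apply/hasPn => w /s2 e; apply/negP => /s1; lia.
- apply: allpairs_uniq_dep => [|w _|]; [exact: ext1_uniq | exact: unused_uniq |].
  by move=> [w b] [w' b'] _ _ /= [-> ->].
Qed.

Lemma mem_biwords j l : j <= n -> (l \in biwords j) = biword (n - j).+1 l.
Proof.
elim: j l => [|j IH] l jn.
  rewrite subn0 inE; apply/eqP/idP => [-> //|]; case: l => // p l /and3P[].
  by case/andP => /and3P[h1 h2 h3]; lia.
have e : (n - j.+1).+1 = n - j by lia.
rewrite e; apply/allpairsPdep/idP => [[l0 [l' [l0b l'l ->]]]|].
  by rewrite IH 1?ltnW // in l0b; have [] := extensions_biword l0b l'l.
move=> /extensions_exists[l0 vl0 ll0]; exists l0, l; split=> //.
by rewrite IH // ltnW.
Qed.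

Lemma biwords_uniq j : j <= n -> uniq (biwords j).
Proof.
elim: j => [|j IH] // jn; apply: allpairs_uniq_dep => [|l|].
- exact/IH/ltnW.
- by rewrite mem_biwords 1?ltnW // => /extensions_uniq.
rewrite -/(biwords j) => p p' /allpairsPdep [x [y [xb xy ->]]].
move=> /allpairsPdep [x' [y' [xb' xy' ->]]] /= yy; rewrite yy in xy *.
rewrite !mem_biwords 1?ltnW // in xb xb'.
have [_ fx] := extensions_biword xb xy; have [_ fx'] := extensions_biword xb' xy'.
by rewrite -fx -fx'.
Qed.

End Biwords.

Local Open Scope ring_scope.

(** * Sums over words of edges as umbral values *)

Section SlotPolynomials.
Variables (A : comNzRingType) (U V : A).

(* Reading the walks of [epow U V] backwards; [i] letters remain, [k] labels are
   available to the next one. *)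
Fixpoint slot_poly (i k : nat) : A :=
  if i is i'.+1 then
    slot_poly i' k.+1 + k%:R * (V * slot_poly i' k) +
    (k * k.-1)%:R * (U * slot_poly i' k.-1)
  else (k == 1%N)%:R.

(** This is [slot_poly] divided by k!, which turns its recursion into the transpose of that of
    [epow]. *)
Fixpoint back_poly (i k : nat) : A :=
  if i is i'.+1 then
    k.+1%:R * back_poly i' k.+1 + k%:R * (V * back_poly i' k) +
    k.-1%:R * (U * back_poly i' k.-1)
  else (k == 1%N)%:R.

Lemma slot_polyE i k : slot_poly i k = k`!%:R * back_poly i k.
Proof.
elim: i k => [|i IH] k /=.
  by case: k => [|[|k]] /=; rewrite ?mulr0 ?mulr1.
rewrite !IH !mulrDr factS; case: k => [|k] /=; first by rewrite fact0; ring.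
rewrite !factS !natrM; ring.
Qed.

Lemma back_poly_eq0 i k : (i.+1 < k)%N -> back_poly i k = 0.
Proof.
elim: i k => [|i IH] k ik /=; first by rewrite gtn_eqF.
rewrite (IH k.+1); last by lia.
rewrite (IH k); last by lia.
rewrite (IH k.-1); last by lia.
by rewrite !mulr0 !addr0.
Qed.

(** Unfolding i steps of the recursion for [epow U V (m + i) 1] leaves [back_poly i k] as the
    coefficient of [epow U V m k]. *)
Lemma sum_back_poly i m B : (i.+1 < B)%N ->
  \sum_(k < B) back_poly i k * epow U V m k = epow U V (m + i) 1.
Proof.
elim: i m B => [|i IH] m B iB.
  rewrite addn0 (bigD1 (Ordinal iB)) //= mul1r big1 ?addr0 // => k.
  by rewrite -val_eqE /= => /negPf ->; rewrite mul0r.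
rewrite addnS -addSn -(IH m.+1 B) ?(ltnW iB) //; case: B iB => // B iB.
pose g k := k%:R * back_poly i k; pose e := epow U V m.
transitivity (\sum_(k < B.+1) (g k.+1 * e k) + \sum_(k < B.+1) (V * g k * e k) +
    \sum_(k < B.+1) (U * g k.-1 * e k)).
  by rewrite -!big_split; apply: eq_bigr => k _ /=; rewrite /g /e; ring.
transitivity (\sum_(k < B.+1) (g k * e k.-1) + \sum_(k < B.+1) (V * g k * e k) +
    \sum_(k < B.+1) (U * g k * e k.+1)); last first.
  by rewrite -!big_split; apply: eq_bigr => k _ /=; rewrite /g /e; ring.
have g0 : g 0%N = 0 by rewrite /g mul0r.
have gB k : (B <= k)%N -> g k = 0 by move=> Bk; rewrite /g back_poly_eq0 ?mulr0 //; lia.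
congr (_ + _ + _).
  rewrite big_ord_recr /= gB // mul0r addr0 [RHS]big_ord_recl g0 mul0r add0r.
  by apply: eq_bigr => k _; rewrite lift0.
rewrite big_ord_recl /= g0 mulr0 mul0r add0r [RHS]big_ord_recr /= gB // mulr0 mul0r addr0.
by apply: eq_bigr => k _; rewrite /bump leq0n add1n.
Qed.

(** At m = 1 only the summand k = 1 survives, since E starts with z. *)
Lemma slot_poly1 i : slot_poly i 1 = epow U V i.+1 1.
Proof.
rewrite slot_polyE mul1r -add1n -(@sum_back_poly i 1 i.+2) //.
rewrite (bigD1 (Ordinal (isT : (1 < i.+2)%N))) //= big1 => [|k].
  by ring.
rewrite -val_eqE /=; case: (nat_of_ord k) => [|[|j]] //= _; rewrite ?mul0r ?mulr0 //.
ring.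
Qed.

End SlotPolynomials.

(** Extends [toric_umbral], its value at the state [(true, 0)], to all states, so that V and U act
    as insertion of one and of two copies of a letter. *)
Definition asc_umbral (b : bool) (m : nat) (p : {poly Kx}) : Kx :=
  umbral (fun i => asc_poly i b m) p.

Lemma asc_umbralX b m p :
  asc_umbral b m ('X * p) = insert1 (fun b m => asc_umbral b m p) b m.
Proof.
rewrite /asc_umbral umbralX /= /insert1; case: b.
  by rewrite umbral_add umbral_scale umbral_exchange.
by rewrite 2!umbral_add umbral_scale umbral_exchange.
Qed.

Lemma asc_umbral_compatible p : asc_compatible (fun b m => asc_umbral b m p).
Proof.
move=> m; rewrite /asc_umbral -!umbral_scale -umbral_add.
by apply: eq_umbral => i; apply: asc_poly_compatible.
Qed.

Lemma asc_umbralU b m p : b || (0 < m)%N ->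
  asc_umbral b m (('X + sX%:P) * p) = insert2 (fun b m => asc_umbral b m p) b m.
Proof.
move=> bm; rewrite insert2E //; last exact: asc_umbral_compatible.
by rewrite mulrDl -asc_umbralX /asc_umbral umbralD umbralZ.
Qed.

Section BiwordSums.
Variable n : nat.

Lemma sum_ext1 F v l : biword n v.+1 l ->
  \sum_(w <- ext1 n v l) word_weight F (unzip1 w) =
  (size (unused n v l))%:R * word_weight (insert1 F) (unzip1 l).
Proof.
move=> vl; rewrite big_allpairs_dep -(sum_insert_at _ (biword_all vl)) mulr_sumr.
rewrite /index_iota subn0; apply: eq_bigr => r _.
under eq_bigr => b _ do rewrite unzip1_insert /=.
by rewrite big_const_seq count_predT iter_addr_0 mulr_natl.
Qed.

Lemma size_biword v l : biword n v l -> (size l <= n.+1 - v)%N.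
Proof.
move=> vl; have /and3P[_ ul _] := vl.
rewrite -(size_map snd) -[leqRHS](size_iota v.+1); apply: uniq_leq_size => // b.
by move/(allP (biword_labels vl)); rewrite mem_iota; lia.
Qed.

Lemma sum_ext2 F v l : biword n v.+1 l ->
  \sum_(w <- ext2 n v l) word_weight F (unzip1 w) =
  (size (unused n v l) * (size (unused n v l)).-1)%:R *
    word_weight (insert2 F) (unzip1 l).
Proof.
move=> vl; have [_ ul _] := and3P vl.
have lab m (w : seq (nat * nat)) : biword n m w -> (v <= m)%N ->
    size (unused n v w) = (n.+1 - v - size w)%N.
  move=> mw vm; have vw := biword_leq vm mw; have [_ uw _] := and3P vw.
  by rewrite size_unused // (biword_labels vw).
rewrite 2!big_allpairs_dep -(sum_insert_at2 _ (biword_all vl)) mulr_sumr.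
rewrite /index_iota subn0 big_seq [RHS]big_seq; apply: eq_bigr => r ri.
have h b : b \in unused n v l -> \sum_(c <- unused n v (insert_at r (v, b) l))
    word_weight F (unzip1 ((v, b) :: insert_at r (v, b) l)) =
    (size (unused n v l)).-1%:R * word_weight F (v :: insert_at r v (unzip1 l)).
  move=> bl; have : insert_at r (v, b) l \in ext1 n v l.
    by apply: allpairs_f.
  move/(mem_ext1 vl) => [_ [_ [_ _ _ vw]]].
  rewrite /= unzip1_insert big_const_seq count_predT iter_addr_0 mulr_natl /=.
  congr (_ *+ _); rewrite (lab _ _ vw) // (lab _ _ vl) //.
  by rewrite (perm_size (perm_insert _ _ _)) /=; lia.
transitivity (\sum_(b <- unused n v l)
  (size (unused n v l)).-1%:R * word_weight F (v :: insert_at r v (unzip1 l))).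
  rewrite big_seq [RHS]big_seq; apply: eq_bigr => b bl; rewrite -(h b bl).
  by apply: eq_bigr => c _.
by rewrite big_const_seq count_predT iter_addr_0 -[LHS]mulr_natl natrM mulrA.
Qed.

Lemma word_stateP u : (weak_descents u == 0%N) || (0 < incr_prefix u)%N.
Proof. by case: u => // a u; rewrite incr_prefix_gt0 orbT. Qed.

Let slots i k := slot_poly ('X + sX%:P) 'X i k : {poly Kx}.
(** The total weight of all completions of a partial word by letters at most n - j; [j.+1 - size l]
    child labels are open to the letter n - j. *)
Let stage_weight j (l : seq (nat * nat)) :=
  word_weight (fun b m => asc_umbral b m (slots (n - j) (j.+1 - size l))) (unzip1 l).

(** Using the letter n - j never, once or twice matches the three summands of [slot_poly], whose
    factors V and U perform the insertions. *)
Lemma sum_biwordsS j : (j < n)%N ->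
  \sum_(l <- biwords n j.+1) stage_weight j.+1 l =
  \sum_(l <- biwords n j) stage_weight j l.
Proof.
move=> jn; rewrite big_allpairs_dep big_seq [RHS]big_seq; apply: eq_bigr => l.
rewrite (mem_biwords _ (ltnW jn)) => vl; have sl := size_biword vl.
have [_ ul _] := and3P vl; have lab := biword_labels (biword_leq (leqnSn _) vl).
have sf : size (unused n (n - j) l) = (j.+1 - size l)%N.
  by rewrite size_unused //; congr (_ - _)%N; rewrite subSn ?leq_subr // subKn // ltnW.
rewrite big_cons big_cat /=; set k := (j.+1 - size l)%N.
have e1 : \sum_(w <- ext1 n (n - j) l) stage_weight j.+1 w =
    \sum_(w <- ext1 n (n - j) l)
      word_weight (fun b m => asc_umbral b m (slots (n - j.+1) k)) (unzip1 w).
  rewrite big_seq [RHS]big_seq; apply: eq_bigr => w.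
  move=> /(mem_ext1 vl) [r [b [_ _ -> _]]].
  by rewrite /stage_weight (perm_size (perm_insert _ _ _)) subSS.
have e2 : \sum_(w <- ext2 n (n - j) l) stage_weight j.+1 w =
    \sum_(w <- ext2 n (n - j) l)
      word_weight (fun b m => asc_umbral b m (slots (n - j.+1) k.-1)) (unzip1 w).
  rewrite big_seq [RHS]big_seq; apply: eq_bigr => w.
  case/allpairsPdep=> w' [c [/(mem_ext1 vl) [r [b [_ _ -> _]]] _ ->]].
  by rewrite /stage_weight /= (perm_size (perm_insert _ _ _)) /= !subSS /k -subn1 subnAC subn1.
rewrite e1 e2 sum_ext1 // sum_ext2 // sf -/k /stage_weight.
rewrite subSS (subKn (ltnW jn)) in sl.
have -> : (j.+2 - size l = k.+1)%N by rewrite subSn // leqW.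
have -> : (n - j = (n - j.+1).+1)%N by lia.
rewrite -/k /word_weight; set b := _ == _; set m := incr_prefix _.
rewrite -asc_umbralX -asc_umbralU ?word_stateP //.
rewrite mulrCA [_%:R * ('X^_ * _)]mulrCA -!mulrDr; congr (_ * _).
have natZ a q : (a%:R : Kx) * asc_umbral b m q = asc_umbral b m (a%:R * q).
  by rewrite /asc_umbral -umbralZ polyC_natr.
by rewrite !natZ /asc_umbral -!umbralD addrA.
Qed.

Theorem sum_biwords : \sum_(l <- biwords n n | size l == n)
  'X ^+ weak_descents (unzip1 l) = toric_umbral (perm_h n.+1).
Proof.
have H j : (j <= n)%N -> \sum_(l <- biwords n j) stage_weight j l =
    toric_umbral (perm_h n.+1).
  elim: j => [|j IH] jn; last by rewrite sum_biwordsS // IH // ltnW.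
  rewrite big_seq1 /stage_weight /word_weight mul1r subn0 /slots slot_poly1.
  by [].
rewrite -(H n) // big_seq_cond [RHS]big_seq big_mkcondr; apply: eq_bigr => l.
rewrite mem_biwords // subnn => /size_biword; rewrite subn1 /= => sl.
rewrite /stage_weight subnn /word_weight /slots /=.
(* At the end the only label left must be 1, that of the root, so just the words with n edges
   count. *)
have -> : (n.+1 - size l == 1)%N = (size l == n) by lia.
by case: eqP => _; rewrite /asc_umbral ?umbral1 ?umbral0 ?mulr1 ?mulr0.
Qed.

End BiwordSums.

(** * Parking trees and words of edges *)

Local Close Scope ring_scope.

Section ParkingTrees.

Lemma ptree_nested_ind (P : ptree -> Prop) :
  (forall v cs, foldr (fun c Q => P c.2 /\ Q) True cs -> P (PNode v cs)) ->
  forall t, P t.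
Proof.
move=> H; fix F 1; case=> v cs; apply: H.
exact: ((fix G cs : foldr (fun c Q => P c.2 /\ Q) True cs :=
  if cs is c :: cs' then conj (F c.2) (G cs') else I) cs).
Qed.

(* One triple [(edge, (parent, child))] per edge. *)
Fixpoint tree_edges (t : ptree) : seq (nat * (nat * nat)) :=
  let: PNode v cs := t in
  flatten [seq (c.1, (v, root_label c.2)) :: tree_edges c.2 | c <- cs].

Lemma edge_parentsE t : edge_parents t = [seq (e.1, e.2.1) | e <- tree_edges t].
Proof.
elim/ptree_nested_ind: t => v cs; rewrite /=.
by elim: cs => //= c cs IH [-> /IH ->]; rewrite map_cat.
Qed.

Lemma edge_labelsE t : edge_labels t = unzip1 (tree_edges t).
Proof. by rewrite /edge_labels edge_parentsE /unzip1 -map_comp. Qed.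

Lemma perm_tree_edges v cs : perm_eq (tree_edges (PNode v cs))
  ([seq (c.1, (v, root_label c.2)) | c <- cs] ++ flatten [seq tree_edges c.2 | c <- cs]).
Proof.
elim: cs => //= c cs IH; rewrite perm_cons.
by rewrite perm_sym perm_catCA perm_cat2l perm_sym.
Qed.

Lemma perm_vertex_labels t :
  perm_eq (vertex_labels t) (root_label t :: [seq e.2.2 | e <- tree_edges t]).
Proof.
elim/ptree_nested_ind: t => v cs /= H; rewrite perm_cons.
elim: cs H => //= -[i t] cs IH [/= tP /IH csP].
rewrite map_cat -cat_cons; exact: perm_cat.
Qed.

Lemma root_edges (v : nat) (cs : seq (nat * ptree)) (e : nat * (nat * nat)) :
  e \in [seq (c.1, (v, root_label c.2)) | c <- cs] -> e.2.1 = v.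
Proof. by elim: cs => //= c cs IH; rewrite inE => /predU1P[->|/IH]. Qed.

Lemma edge_parent_mem t e : e \in tree_edges t -> e.2.1 \in vertex_labels t.
Proof.
elim/ptree_nested_ind: t => v cs H.
rewrite (perm_mem (perm_tree_edges v cs)) mem_cat [vertex_labels _]/= inE => /orP[eP|eP].
  by rewrite (root_edges eP) eqxx.
apply/orP; right; elim: cs H eP => //= c cs IH [cP /IH csP].
by rewrite !mem_cat => /orP[/cP ->|/csP ->]; rewrite ?orbT.
Qed.

Lemma forest_parent_mem (cs : seq (nat * ptree)) e :
  e \in flatten [seq tree_edges c.2 | c <- cs] ->
  e.2.1 \in flatten [seq vertex_labels c.2 | c <- cs].
Proof.
elim: cs => //= c cs IH; rewrite !mem_cat => /orP[/edge_parent_mem ->//|/IH ->].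
by rewrite orbT.
Qed.

Lemma vertex_increasing_edges t : vertex_increasing t ->
  all (fun e => e.2.1 < e.2.2) (tree_edges t).
Proof.
elim/ptree_nested_ind: t => v cs /=.
elim: cs => //= c cs IH [cP /IH csP] /andP[/andP[-> /cP cE] /csP csE].
by rewrite all_cat cE.
Qed.

Section Build.
Variable m : seq (nat * nat).
Let n := size m.

Definition parent_of i := (nth (0, 0) m i.-1).1.
Definition child_of i := (nth (0, 0) m i.-1).2.
Definition child_edges v := [seq i <- iota 1 n | parent_of i == v].

(** The fuel suffices once v + d > n, because labels increase along edges and a parent has label at
    most n. *)
Fixpoint build d v : ptree :=
  PNode v (if d is d'.+1 then [seq (i, build d' (child_of i)) | i <- child_edges v]
           else [::]).

Lemma root_build d v : root_label (build d v) = v.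
Proof. by case: d. Qed.

Lemma map_child_of : [seq child_of i | i <- iota 1 n] = unzip2 m.
Proof.
rewrite /unzip2 -[in RHS](mkseq_nth (0, 0) m) /mkseq -map_comp (iotaDl 1 0) -map_comp.
by apply: eq_map.
Qed.

Hypothesis m_ok : all (fun p => [&& 0 < p.1, p.1 < p.2 & p.2 <= n.+1]) m.

Lemma edge_bounds i : i \in iota 1 n ->
  [&& 0 < parent_of i, parent_of i < child_of i & child_of i <= n.+1].
Proof.
rewrite mem_iota => /andP[i1 i2]; apply: (allP m_ok).
by apply: mem_nth; rewrite -/n; lia.
Qed.

Lemma build_unique t d : root_label t + d > n ->
  uniq (vertex_labels t) -> vertex_increasing t -> edge_increasing t ->
  (forall e, e \in tree_edges t ->
     e.1 \in iota 1 n /\ e = (e.1, (parent_of e.1, child_of e.1))) ->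
  (forall i, i \in iota 1 n -> parent_of i \in vertex_labels t ->
     (i, (parent_of i, child_of i)) \in tree_edges t) ->
  t = build d (root_label t).
Proof.
elim/ptree_nested_ind: t d => v cs IHcs d.
rewrite [root_label _]/= => vd uv vi ei H1 H2.
have mem_e e : e \in tree_edges (PNode v cs) =
    (e \in [seq (c.1, (v, root_label c.2)) | c <- cs]) ||
    (e \in flatten [seq tree_edges c.2 | c <- cs]).
  by rewrite (perm_mem (perm_tree_edges v cs)) mem_cat.
have /andP[v_notin uvs] : (v \notin flatten [seq vertex_labels c.2 | c <- cs]) &&
  uniq (flatten [seq vertex_labels c.2 | c <- cs]) by [].
have deep := @forest_parent_mem cs.
(* Siblings are sorted by edge label, so the list of root edges is determined by its elements. *)
have AE : [seq (c.1, (v, root_label c.2)) | c <- cs] =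
    [seq (i, (v, child_of i)) | i <- child_edges v].
  pose r (e e' : nat * (nat * nat)) := e.1 < e'.1.
  apply: (@irr_sorted_eq _ r).
  - by move=> x y z; apply: ltn_trans.
  - by move=> x; rewrite /r ltnn.
  - by case/andP: ei => srt _; rewrite /unzip1 sorted_map in srt; rewrite sorted_map.
  - rewrite sorted_map /=; apply: (sorted_filter ltn_trans); exact: iota_ltn_sorted.
  - move=> e; apply/idP/mapP => [eA|[i]].
      have := H1 e; rewrite mem_e eA => /(_ isT) [e1 eE].
      have pv := root_edges eA; exists e.1; first by rewrite mem_filter e1 -pv eE eqxx.
      by rewrite [LHS]eE -[in RHS]pv [in RHS]eE.
    rewrite mem_filter => /andP[/eqP pv ii] ->.
    have := H2 i ii; rewrite pv [vertex_labels _]/= mem_head => /(_ isT).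
    rewrite mem_e => /orP[//|/deep]; by rewrite /= (negPf v_notin).
case: d vd => [|d] vd.
  case: cs AE {IHcs uv vi ei H1 H2 mem_e v_notin uvs deep} => //= c cs.
  case e: (child_edges v) => [//|i s] _.
  have : i \in child_edges v by rewrite e mem_head.
  rewrite mem_filter => /andP[/eqP pv /edge_bounds]; rewrite pv; lia.
congr PNode; transitivity [seq (e.1, build d e.2.2) |
  e <- [seq (i, (v, child_of i)) | i <- child_edges v]]; last by rewrite -map_comp.
rewrite -AE -map_comp.
have {}H1 e : e \in flatten [seq tree_edges c.2 | c <- cs] ->
    e.1 \in iota 1 n /\ e = (e.1, (parent_of e.1, child_of e.1)).
  by move=> eP; apply: H1; rewrite mem_e eP orbT.
have {}H2 i : i \in iota 1 n -> parent_of i \in flatten [seq vertex_labels c.2 | c <- cs] ->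
    (i, (parent_of i, child_of i)) \in flatten [seq tree_edges c.2 | c <- cs].
  move=> ii pi; have := H2 i ii; rewrite [vertex_labels _]/= inE pi orbT => /(_ isT).
  by rewrite mem_e => /orP[/root_edges/= pv|//]; rewrite -pv pi in v_notin.
case/andP: ei => _; move: vi; rewrite [vertex_increasing _]/=.
elim: cs IHcs {uv mem_e AE v_notin deep} uvs H1 H2 => //= c cs IH [IHc IHcs].
rewrite cat_uniq => /and3P[uc /hasPn dis ucs] H1 H2.
move=> /andP[/andP[vc vic] vics] /andP[eic eics]; congr (_ :: _).
  rewrite -(IHc d) //; first by case: (c).
  - by move: vc vd; lia.
  - by move=> e ec; apply: H1; rewrite mem_cat ec.
  - move=> i ii pi; have := H2 i ii; rewrite !mem_cat pi => /(_ isT) /orP[//|].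
    by move/forest_parent_mem/dis; rewrite /= pi.
apply: IH => // [e ec|i ii pi]; first by apply: H1; rewrite mem_cat ec orbT.
have := H2 i ii; rewrite !mem_cat pi orbT => /(_ isT) /orP[|//].
by move/edge_parent_mem; have /= /negPf-> := dis _ pi.
Qed.

Lemma perm_flatten_fibers (S T : eqType) (f : S -> T) (s : seq S) (r : seq T) :
  uniq r -> perm_eq (flatten [seq [seq i <- s | f i == u] | u <- r])
                    [seq i <- s | f i \in r].
Proof.
elim: r => [|u r IH] /=; first by rewrite (@eq_filter _ _ pred0) // filter_pred0.
case/andP=> ur /IH rP; apply: perm_trans (_ : perm_eq _
  ([seq i <- s | f i == u] ++ [seq i <- s | f i \in r])) _.
  by rewrite perm_cat2l.
apply/permP => a; rewrite count_cat !count_filter.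
rewrite -count_predUI [X in _ + X](_ : _ = 0) ?addn0.
  by apply: eq_count => i /=; rewrite inE andb_orr.
rewrite (@eq_count _ _ pred0) ?count_pred0 // => i /=.
by case: eqP => [->|_]; rewrite ?andbF //= (negPf ur) !andbF.
Qed.

Lemma build_edges d v : v + d > n -> perm_eq (tree_edges (build d v))
  (flatten [seq [seq (i, (u, child_of i)) | i <- child_edges u]
           | u <- vertex_labels (build d v)]).
Proof.
elim: d v => [|d IH] v vd.
  rewrite /= cats0 (_ : child_edges v = [::]) //; apply/eqP; rewrite -[_ == _]negbK -has_filter.
  apply/hasPn => i /edge_bounds; lia.
apply: perm_trans (perm_tree_edges _ _) _; rewrite -map_comp /=.
rewrite -map_comp; apply: perm_cat.
  by rewrite (eq_map (g := fun i => (i, (v, child_of i)))) // => i /=; rewrite root_build.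
have chP i : i \in child_edges v -> child_of i + d > n.
  by rewrite mem_filter => /andP[/eqP pv /edge_bounds]; rewrite pv; lia.
elim: (child_edges v) chP => //= i ch IHch chP.
rewrite map_cat flatten_cat; apply: perm_cat; first exact/IH/chP/mem_head.
by apply: IHch => k kc; apply: chP; rewrite inE kc orbT.
Qed.

(** An occurrence of u below the root hangs from an occurrence of the parent of an edge into u. When
    each non-root vertex has one incoming edge, induction on u then shows that every vertex occurs
    once. *)
Lemma count_build u d v : v + d > n -> count_mem u (vertex_labels (build d v)) =
  (v == u) + \sum_(i <- iota 1 n | child_of i == u)
                count_mem (parent_of i) (vertex_labels (build d v)).
Proof.
elim: d v u => [|d IH] v u vd /=.
  congr (_ + _); rewrite big_seq_cond big1 // => i /andP[/edge_bounds h _].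
  by rewrite addn0; case: eqP => // e; move: h; rewrite -e; lia.
have cf x : count_mem x (flatten [seq vertex_labels c.2
     | c <- [seq (i, build d (child_of i)) | i <- child_edges v]]) =
   \sum_(i <- iota 1 n | parent_of i == v) count_mem x (vertex_labels (build d (child_of i))).
  by rewrite count_flatten sumnE -!map_comp !big_map big_filter.
rewrite cf; under [in RHS]eq_bigr => i _ do rewrite cf.
congr (_ + _); rewrite big_split /= [X in _ = _ + X]exchange_big /=.
have -> : \sum_(i <- iota 1 n | child_of i == u) (v == parent_of i) =
    \sum_(i <- iota 1 n | parent_of i == v) (child_of i == u).
  rewrite big_mkcond [RHS]big_mkcond; apply: eq_bigr => i _.
  by rewrite [v == _]eq_sym; case: (_ == u); case: (_ == v).
rewrite -big_split /= big_seq_cond [RHS]big_seq_cond; apply: eq_bigr => i.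
move=> /andP[/edge_bounds h /eqP pv]; apply: IH.
by move: h; rewrite pv; lia.
Qed.

Hypothesis m_perm : perm_eq (unzip2 m) (iota 2 n).

Lemma build_vertices : perm_eq (vertex_labels (build n 1)) (iota 1 n.+1).
Proof.
have vd : 1 + n > n by [].
have Hc u : \sum_(i <- iota 1 n | child_of i == u) 1 = (1 < u <= n.+1).
  rewrite sum1_count -(count_map child_of (pred1 u)) map_child_of (permP m_perm).
  by rewrite count_uniq_mem ?iota_uniq // mem_iota; congr (nat_of_bool _); lia.
suff H u : count_mem u (vertex_labels (build n 1)) = (0 < u <= n.+1).
  apply/allP => u _ /=; apply/eqP; rewrite H count_uniq_mem ?iota_uniq // mem_iota.
  by lia.
elim/ltn_ind: u => u IH; rewrite (count_build u vd).
have -> : \sum_(i <- iota 1 n | child_of i == u)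
    count_mem (parent_of i) (vertex_labels (build n 1)) =
    \sum_(i <- iota 1 n | child_of i == u) 1.
  rewrite big_seq_cond [RHS]big_seq_cond; apply: eq_bigr => i /andP[/edge_bounds h /eqP cu].
  rewrite IH; last by rewrite -cu; lia.
  by rewrite (_ : _ && _) //; lia.
by rewrite Hc; lia.
Qed.

Lemma build_tree_edges : perm_eq (tree_edges (build n 1))
  [seq (i, (parent_of i, child_of i)) | i <- iota 1 n].
Proof.
apply: perm_trans (build_edges _) _ => //.
apply: (@perm_trans _ (flatten [seq [seq (i, (parent_of i, child_of i)) | i <- child_edges u]
           | u <- iota 1 n.+1])).
  rewrite (eq_map (g := fun u => [seq (i, (parent_of i, child_of i)) | i <- child_edges u])).
    exact/perm_flatten/perm_map/build_vertices.
  by move=> u; apply/eq_in_map => i; rewrite mem_filter => /andP[/eqP ->].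
have -> : [seq [seq (i, (parent_of i, child_of i)) | i <- child_edges u] | u <- iota 1 n.+1] =
  [seq [seq (i, (parent_of i, child_of i)) | i <- s] | s <- [seq child_edges u | u <- iota 1 n.+1]].
  by rewrite -map_comp.
rewrite -map_flatten; apply: perm_map.
apply: perm_trans (perm_flatten_fibers _ _ (iota_uniq _ _)) _.
rewrite (@eq_in_filter _ _ predT) ?filter_predT // => i /edge_bounds h.
by rewrite mem_iota /=; lia.
Qed.

Lemma build_vertex_increasing d v : v + d > n -> vertex_increasing (build d v).
Proof.
elim: d v => [|d IH] v vd //=; rewrite all_map; apply/allP => i /=.
rewrite mem_filter => /andP[/eqP pv /edge_bounds]; rewrite pv root_build => h.
by apply/andP; split; [lia | apply: IH; lia].
Qed.

Lemma build_edge_increasing d v : edge_increasing (build d v).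
Proof.
elim: d v => [|d IH] v //=; apply/andP; split.
  rewrite /unzip1 -map_comp map_id; apply: (sorted_filter ltn_trans); exact: iota_ltn_sorted.
by rewrite all_map; apply/allP => i _ /=.
Qed.

Lemma build_parking_tree : parking_tree n (build n 1).
Proof.
rewrite /parking_tree build_vertices build_edge_increasing build_vertex_increasing //.
rewrite edge_labelsE !andbT; have := perm_map fst build_tree_edges.
by rewrite -map_comp map_id.
Qed.

End Build.
End ParkingTrees.

Definition edge_data (t : ptree) (i : nat) : nat * nat :=
  (nth (0, (0, 0)) (tree_edges t) (index i (edge_labels t))).2.

Lemma edge_dataE t i p : uniq (edge_labels t) -> (i, p) \in tree_edges t ->
  edge_data t i = p.
Proof.
rewrite /edge_data edge_labelsE => ul ip; set E := tree_edges t in ul ip *.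
have ipE : index (i, p) E < size E by rewrite index_mem.
suff -> : index i (unzip1 E) = index (i, p) E by rewrite nth_index.
rewrite -[in LHS](_ : nth 0 (unzip1 E) (index (i, p) E) = i).
  by rewrite index_uniq ?size_map.
by rewrite (nth_map (0, (0, 0))) // nth_index.
Qed.

Lemma encodedE t i : i \in edge_labels t -> encoded t i = (edge_data t i).1.
Proof.
move=> it; rewrite /encoded /edge_data edge_parentsE /unzip2 -map_comp.
by rewrite (nth_map (0, (0, 0))) // -(size_map fst) -[map _ _]edge_labelsE index_mem.
Qed.

(** * Patterns and ascents of a function read as a reversed word *)

Lemma sorted_filterP a u : reflect
  (forall i j, i < j -> j < size u -> nth 0 u j <= nth 0 u i -> a < nth 0 u i)
  (sorted ltn [seq b <- u | b <= a]).
Proof.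
rewrite (sorted_pairwise ltn_trans).
elim: u => [|b u IH] /=; first by apply: ReflectT.
case: ifP => [ba|ba] /=.
  apply: (iffP andP) => [[/allP au /IH pu] [|i] [|j] //= ij ju|h].
  - move=> uj; have := au (nth 0 u j); rewrite mem_filter mem_nth // andbT.
    by rewrite (leq_trans uj ba) /= ltnNge uj => /(_ isT).
  - exact: pu.
  split; last by apply/IH => i j ij ju; apply: (h i.+1 j.+1).
  apply/allP => c; rewrite mem_filter => /andP[ca /(nthP 0)[j ju jc]].
  rewrite /= ltnNge; apply/negP => cb; have := h 0 j.+1 isT ju.
  by rewrite /= jc ltnNge ba => /(_ cb).
apply: (iffP IH) => [h [|i] [|j] //= ij ju|h i j ij ju].
- by rewrite ltnNge ba.
- exact: h.
- exact: (h i.+1 j.+1).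
Qed.

Lemma avoids321P u : reflect
  (forall i j k, i < j -> j < k -> k < size u ->
     ~ (nth 0 u k <= nth 0 u j <= nth 0 u i))
  (avoids321 u).
Proof.
elim: u => [|a u IH] /=; first by apply: ReflectT.
apply: (iffP andP) => [[/sorted_filterP h /IH hu]|h].
  move=> [|i] [|j] [|k] //=; rewrite !ltnS => ij jk ku; last exact: hu.
  by case/andP=> kj ja; have := h j k jk ku kj; rewrite ltnNge ja.
split; last by apply/IH => i j k ij jk ku; apply: (h i.+1 j.+1 k.+1).
apply/sorted_filterP => i j ij ju uji; rewrite ltnNge; apply/negP => ia.
by apply: (h 0 i.+1 j.+1); rewrite //= uji.
Qed.

Section WordOfFunction.
Variables (n : nat) (f : nat -> nat).
Let u := rev [seq f i | i <- iota 1 n].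

Lemma nth_fun_word i : i < n -> nth 0 u i = f (n - i).
Proof.
move=> ni; rewrite nth_rev size_map size_iota // (nth_map 0) ?size_iota; last by lia.
by rewrite nth_iota ?add1n ?subnSK //; lia.
Qed.

Lemma avoids123P : avoids123 n f <-> avoids321 u.
Proof.
have su : size u = n by rewrite size_rev size_map size_iota.
split=> [av|/avoids321P av].
  apply/avoids321P => i j k ij jk; rewrite su => kn.
  rewrite !nth_fun_word; try by lia.
  move=> le; apply: av; exists (n - k), (n - j), (n - i); split=> //.
  by split; lia.
move=> [i1 [i2 [i3 [[h1 h12 h23 h3] le]]]].
apply: (av (n - i3) (n - i2) (n - i1)); rewrite ?su; try by lia.
rewrite !nth_fun_word; try by lia.
by rewrite !subKn //; lia.
Qed.

End WordOfFunction.

Lemma ascentsE n f : ascents n f = weak_descents (rev [seq f i | i <- iota 1 n]).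
Proof.
rewrite /ascents; case: n => // n; rewrite [n.+1.-1]/=.
elim: n => // n IH.
have iotaS m : iota 1 m.+1 = rcons (iota 1 m) m.+1.
  by rewrite -cats1 -[X in iota _ X]addn1 iotaD add1n.
have -> : count (fun i => f i <= f i.+1) (iota 1 n.+1) =
    count (fun i => f i <= f i.+1) (iota 1 n) + (f n.+1 <= f n.+2).
  by rewrite iotaS -cats1 count_cat /= addn0.
by rewrite IH (iotaS n.+1) (iotaS n) !map_rcons !rev_rcons weak_descents2 addnC.
Qed.

Definition tree_word (n : nat) (t : ptree) : seq (nat * nat) :=
  [seq edge_data t i | i <- iota 1 n].

Definition word_tree (m : seq (nat * nat)) : ptree := build m (size m) 1.

Definition edge_word (m : seq (nat * nat)) : bool :=
  all (fun p => [&& 0 < p.1, p.1 < p.2 & p.2 <= (size m).+1]) m &&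
  perm_eq (unzip2 m) (iota 2 (size m)).

Lemma tree_word_build m : edge_word m -> tree_word (size m) (word_tree m) = m.
Proof.
case/andP=> m_ok m_perm; have tP := build_tree_edges m_ok m_perm.
rewrite -[RHS](mkseq_nth (0, 0)) /mkseq /tree_word (iotaDl 1 0) -map_comp.
apply/eq_in_map => i; rewrite mem_iota /= add0n => im.
have [_ lP _ _] := and4P (build_parking_tree m_ok m_perm).
rewrite add1n; apply: edge_dataE; first by rewrite (perm_uniq lP) iota_uniq.
rewrite (perm_mem tP); apply/mapP; exists i.+1; first by rewrite mem_iota; lia.
by rewrite /parent_of /child_of -surjective_pairing.
Qed.

Section ParkingTreeWord.
Variables (n : nat) (t : ptree).
Hypothesis tP : parking_tree n t.
Let m := tree_word n t.

Let size_m : size m = n.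
Proof. by rewrite size_map size_iota. Qed.

Let labels_uniq : uniq (edge_labels t).
Proof. by case/and4P: tP => _ /perm_uniq -> _ _; rewrite iota_uniq. Qed.

Let edge_mem i p : (i, p) \in tree_edges t -> i \in iota 1 n /\ p = edge_data t i.
Proof.
case/and4P: tP => _ /perm_mem lP _ _ ip; split; last by rewrite (edge_dataE labels_uniq ip).
by rewrite -lP edge_labelsE; apply: (map_f fst ip).
Qed.

Let mem_edge i : i \in iota 1 n -> (i, edge_data t i) \in tree_edges t.
Proof.
case/and4P: tP => _ /perm_mem lP _ _; rewrite -lP edge_labelsE => /mapP[[j p] jp /= ->].
by rewrite (edge_dataE labels_uniq jp).
Qed.

Let nth_word i : i \in iota 1 n -> nth (0, 0) m i.-1 = edge_data t i.
Proof.
rewrite mem_iota => /andP[i1 i2]; rewrite (nth_map 0) ?size_iota; last by lia.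
by rewrite nth_iota ?add1n ?prednK //; lia.
Qed.

Let vertex_bounds e : e \in tree_edges t -> [&& 0 < e.2.1, e.2.1 < e.2.2 & e.2.2 <= n.+1].
Proof.
case/and4P: tP => /perm_mem vP _ /vertex_increasing_edges/allP vi _ et.
have := edge_parent_mem et; rewrite vP mem_iota => /andP[-> _].
rewrite (vi _ et); have : e.2.2 \in vertex_labels t.
  by rewrite (perm_mem (perm_vertex_labels t)) inE (map_f (fun e => e.2.2) et) orbT.
by rewrite vP mem_iota; lia.
Qed.

Let root1 : root_label t = 1.
Proof.
case/and4P: tP => /perm_mem vP _ _ _; have := vP 1.
rewrite (perm_mem (perm_vertex_labels t)) inE mem_iota /= => /orP[/eqP //|].
by case/mapP => e /vertex_bounds + e1; rewrite -e1; lia.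
Qed.

Lemma edge_word_tree : edge_word m.
Proof.
rewrite /edge_word size_m; apply/andP; split.
  by rewrite all_map; apply/allP => i /mem_edge/vertex_bounds.
case/and4P: tP => vP lP _ _.
have : perm_eq (root_label t :: [seq e.2.2 | e <- tree_edges t]) (iota 1 n.+1).
  by rewrite perm_sym in vP; rewrite perm_sym; apply: perm_trans vP (perm_vertex_labels t).
rewrite root1 /= perm_cons; apply: perm_trans.
have -> : [seq e.2.2 | e <- tree_edges t] = [seq (edge_data t i).2 | i <- edge_labels t].
  rewrite edge_labelsE -map_comp; apply/eq_in_map => -[i p] /edge_mem[_ ->].
  by [].
by rewrite /unzip2 -map_comp; apply: perm_map; rewrite perm_sym.
Qed.

Lemma word_tree_word : word_tree m = t.
Proof.
have /andP[m_ok _] := edge_word_tree; rewrite /word_tree -root1; apply/esym.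
case/and4P: tP => vP _ vi ei.
apply: (build_unique m_ok); rewrite ?root1 //.
- by rewrite (perm_uniq vP) iota_uniq.
- move=> [i p] /edge_mem[ii ->]; rewrite /= size_m /parent_of /child_of nth_word //.
  by rewrite -surjective_pairing.
- move=> i; rewrite size_m => ii _; rewrite /parent_of /child_of nth_word //.
  by rewrite -surjective_pairing; apply: mem_edge.
Qed.

Lemma unzip1_tree_word : unzip1 m = [seq encoded t i | i <- iota 1 n].
Proof.
rewrite /unzip1 -map_comp; apply/eq_in_map => i /= ii; rewrite encodedE //.
by case/and4P: tP => _ /perm_mem -> _ _.
Qed.

(** The vertices 2, ..., k + 1 are the children of k distinct edges, whose parents are smaller and
    hence lie in [k]. *)
Lemma parking_function_encoded : parking_function n (encoded t).
Proof.
have /andP[m_ok m_perm] := edge_word_tree; rewrite size_m in m_ok m_perm.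
have fE i : i \in iota 1 n -> encoded t i = (edge_data t i).1.
  by move=> ii; rewrite encodedE //; case/and4P: tP => _ /perm_mem -> _ _.
split=> [i i_n|k kn].
  have ii : i \in iota 1 n by rewrite mem_iota; lia.
  by rewrite fE //; have := vertex_bounds (mem_edge ii); rewrite /=; lia.
have kE : k = count (fun b => b <= k.+1) (unzip2 m).
  rewrite (permP m_perm) -[n](@subnKC k) ?iotaD ?count_cat; last by lia.
  rewrite (_ : count _ (iota 2 k) = k); last first.
    apply/eqP; rewrite -[X in _ == X](size_iota 2) -all_count; apply/allP => b.
    by rewrite mem_iota; lia.
  rewrite (_ : count _ (iota _ (n - k)) = 0) ?addn0 //.
  apply/eqP; rewrite -leqn0 leqNgt -has_count; apply/hasPn => b.
  by rewrite mem_iota; lia.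
rewrite {1}kE /unzip2 -map_comp count_map.
rewrite (@eq_in_count _ _ (fun i => (i \in iota 1 n) && ((edge_data t i).2 <= k.+1))).
  apply: sub_count => i /andP[ii ik]; rewrite fE //.
  by have := vertex_bounds (mem_edge ii); rewrite /=; lia.
by move=> i ->.
Qed.

End ParkingTreeWord.

From mathcomp Require Import fingroup perm.
From mathcomp Require Import boolp classical_sets functions cardinality reals.

(** * Faces of the permutahedron *)

Local Open Scope ring_scope.

Section Compatible.
Variables (N : nat) (d : Order.disp_t) (O : orderType d).
Implicit Types (f : 'I_N -> O) (p : 'S_N).

Definition compatible f p : bool :=
  [forall i, forall j, (f i < f j)%O ==> (p i < p j)%N].

Lemma compatibleP f p :
  reflect (forall i j, (f i < f j)%O -> (p i < p j)%N) (compatible f p).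
Proof.
apply: (iffP forallP) => [h i j|h i]; first by have /forallP/(_ j)/implyP := h i.
by apply/forallP => j; apply/implyP/h.
Qed.

Lemma compatible_inj f : injective f -> exists p, compatible f p.
Proof.
move=> f_inj; pose r i := #|[set j | (f j < f i)%O]|.
have r_lt i : (r i < N)%N.
  rewrite -[X in (_ < X)%N]card_ord -cardsT; apply: proper_card.
  by apply/properP; split; [exact: finset.subsetT | exists i; rewrite !inE ?ltxx].
have r_mono i j : (f i < f j)%O -> (r i < r j)%N.
  move=> ij; apply: proper_card; apply/properP; split.
    by apply/fintype.subsetP => k; rewrite !inE => /lt_trans; apply.
  by exists i; rewrite !inE ?ltxx.
have g_inj : injective (fun i => Ordinal (r_lt i)).
  move=> i j [rij]; case: (ltgtP (f i) (f j)) => [/r_mono|/r_mono|/f_inj //];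
  by rewrite rij ltnn.
by exists (perm g_inj); apply/compatibleP => i j; rewrite !permE; apply: r_mono.
Qed.

End Compatible.

Section CompatibleLevels.
Variable N : nat.
Implicit Types (f g : 'I_N -> nat).

(* Breaking ties in favour of [j] separates the pair [i], [j]. *)
Lemma compatible_sep f i j : i != j -> (f j <= f i)%N ->
  exists2 p, compatible f p & (p j < p i)%N.
Proof.
(* The tie-breaking digit is at most N, so the base [N.+2] keeps the order lexicographic; the digit
   0 puts j first in its level. *)
move=> ij fji; pose key k := (f k * N.+2 + (if k == j then 0 else k.+1))%N.
have key_lt k l : (f k < f l)%N -> (key k < key l)%N.
  move=> fkl; rewrite /key.
  have := leq_mul fkl (leqnn N.+2); rewrite mulSn.
  by have := ltn_ord k; case: ifP => _; case: ifP => _; lia.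
have key_inj : injective key.
  move=> k l ekl; apply/eqP; have [||fkl] := ltngtP (f k) (f l).
  - by move/key_lt; rewrite ekl ltnn.
  - by move/key_lt; rewrite ekl ltnn.
  - move/eqP: ekl; rewrite /key fkl eqn_add2l.
    by case: (k =P j) => [->|_]; case: (l =P j) => [->|_] //; rewrite eqSS.
have [p /compatibleP p_key] := compatible_inj key_inj.
exists p; first by apply/compatibleP => k l /key_lt; apply: p_key.
apply: p_key; rewrite /key eqxx (negPf ij).
have := leq_mul fji (leqnn N.+2); rewrite ltEnat /=; lia.
Qed.

Lemma compatible_exists f : exists p, compatible f p.
Proof.
have [[i [j ij]]|h] := pselect (exists i j : 'I_N, i != j).
  have [le|le] := leqP (f j) (f i); first by have [p] := compatible_sep ij le; exists p.
  by rewrite eq_sym in ij; have [p] := compatible_sep ij (ltnW le); exists p.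
exists 1%g; apply/compatibleP => i j.
have -> : i = j by apply/eqP; apply/negP => /negP ij; apply: h; exists i, j.
by rewrite ltxx.
Qed.

(** Translates inclusion of vertex sets into implication of strict orders; a pair violating the
    implication is exposed by [compatible_sep]. *)
Lemma compatible_sub f g :
  (forall p, compatible f p -> compatible g p) <->
  (forall i j, (g i < g j)%N -> (f i < f j)%N).
Proof.
split=> [h i j gij|h p /compatibleP fp]; last first.
  by apply/compatibleP => i j /h/fp.
rewrite ltnNge; apply/negP => fji.
have ij : i != j by apply: contraTneq gij => ->; rewrite ltnn.
have [p /h /compatibleP/(_ i j gij)] := compatible_sep ij fji.
by move/ltn_trans => lt /lt; rewrite ltnn.
Qed.

End CompatibleLevels.

Section Rearrangement.
Variables (R : realType) (N : nat).
Implicit Types (a : 'rV[R]_N) (p q : 'S_N).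

Lemma perm_count p i : (\sum_j (p j < p i)%N = p i)%N.
Proof.
rewrite -[RHS](card_ord (p i)) -sum1_card.
rewrite (big_ord_widen N (fun=> 1)%N) ?(ltnW (ltn_ord _)) //.
rewrite [RHS]big_mkcond [RHS](reindex_inj (@perm_inj _ p)) /=.
by apply: eq_bigr => j _; case: ltnP.
Qed.

(* Each unordered pair is counted twice; a pair contributes nonnegatively when
   [q] orders it as [a] does. *)
Lemma dot_gap a p q :
  (dot a (perm_vector R q) - dot a (perm_vector R p)) *+ 2 =
  \sum_i \sum_j (a 0 j - a 0 i) * ((q i < q j)%N%:R - (p i < p j)%N%:R).
Proof.
pose D i j : R := (q i < q j)%N%:R - (p i < p j)%N%:R.
have Dsym i j : D j i = - D i j.
  rewrite /D; have [->|ij] := eqVneq i j; first by rewrite !ltnn !subrr oppr0.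
  have neq (r : 'S_N) : (r i == r j :> nat) = false.
    by rewrite (inj_eq val_inj) (inj_eq perm_inj) (negPf ij).
  have := neq p; have := neq q.
  by case: (ltngtP (q i) (q j)) => // _ _; case: (ltngtP (p i) (p j)) => //= _ _; ring.
have e : dot a (perm_vector R q) - dot a (perm_vector R p) =
    \sum_i \sum_j a 0 j * D i j.
  rewrite exchange_big /dot -sumrB; apply: eq_bigr => j _.
  rewrite !mxE -mulr_sumr -mulrBr /D sumrB -!natr_sum !perm_count.
  by rewrite -!natr1; ring.
rewrite mulr2n {1}e e [X in X + _]exchange_big -big_split /=.
apply: eq_bigr => i _; rewrite -big_split; apply: eq_bigr => j _ /=.
by rewrite Dsym -/(D i j); ring.
Qed.

(** The rearrangement inequality with its equality case: all summands of [dot_gap] are nonnegative,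
    so equality forces each of them to vanish. *)
Lemma dot_compatible a p q : compatible (a 0) q ->
  dot a (perm_vector R p) <= dot a (perm_vector R q)
    ?= iff compatible (a 0) p.
Proof.
move=> /compatibleP cq.
have t0 i j : 0 <= (a 0 j - a 0 i) * ((q i < q j)%N%:R - (p i < p j)%N%:R) :> R.
  case: (ltgtP (a 0 i) (a 0 j)) => [ij|ji|->]; last by rewrite subrr mul0r.
    by rewrite (cq _ _ ij) mulr_ge0 // subr_ge0 ?(ltW ij) // lern1; case: ltnP.
  have := cq _ _ ji; rewrite ltnNge leq_eqVlt negb_or -ltnNge => /andP[_].
  rewrite ltnNge => /negPf ->; rewrite sub0r mulrN -mulNr opprB mulr_ge0 //.
  by rewrite subr_ge0 ltW.
have gap := dot_gap a p q.
have le_pq : dot a (perm_vector R p) <= dot a (perm_vector R q).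
  by rewrite -subr_ge0 -(pmulrn_lge0 _ (isT : (0 < 2)%N)) gap sumr_ge0 // => i _;
    rewrite sumr_ge0.
split=> //; rewrite eq_sym -subr_eq0.
have double_eq0 (x : R) : (x == 0) = (x *+ 2 == 0) by rewrite mulrn_eq0.
rewrite double_eq0 gap psumr_eq0 => [|i _]; last by rewrite sumr_ge0.
apply/allP/compatibleP => [h i j ij|cp i _].
  have /implyP/(_ isT) := h i (mem_index_enum i); rewrite psumr_eq0 // => /allP.
  move=> /(_ j (mem_index_enum j)); rewrite (cq _ _ ij) mulf_eq0 subr_eq0.
  by rewrite gt_eqF //=; case: ltnP => //; rewrite subr0 oner_eq0.
rewrite /= psumr_eq0 //; apply/allP => j _ /=; rewrite mulf_eq0 !subr_eq0.
case: (ltgtP (a 0 i) (a 0 j)) => [ij|ji|_] //=.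
  by rewrite (cq _ _ ij) (cp _ _ ij) eqxx.
by rewrite !ltnNge (ltnW (cq _ _ ji)) (ltnW (cp _ _ ji)) eqxx.
Qed.

End Rearrangement.

(** A strictly monotone function is injective on chains, which bounds their length; stepping down by
    one repeatedly builds a chain attaining the bound. *)
Lemma rank_eq (d : Order.disp_t) (T : finTBPOrderType d) (r : T -> nat) :
  (forall x y, (x < y)%O -> (r x < r y)%N) ->
  (forall x k, r x = k.+1 -> exists2 y, (y < x)%O & r y = k) ->
  forall x, rank x = r x.
Proof.
move=> r_mono r_cover x; apply/eqP; rewrite eqn_leq; apply/andP; split.
  apply/bigmax_leqP => C /andP[/forall_inP Cx /forall_inP Cc].
  have r_inj : {in C &, injective r}.
    move=> u v uC vC ruv; have /forall_inP/(_ v vC) := Cc u uC.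
    by case/comparable_ltgtP => // /r_mono; rewrite ruv ltnn.
  have rC : {subset [seq r u | u <- enum C] <= iota 0 (r x)}.
    move=> k /mapP[u]; rewrite mem_enum => /Cx/r_mono ux ->.
    by rewrite mem_iota.
  rewrite cardE -(size_map r) -[leqRHS](size_iota 0); apply: uniq_leq_size rC.
  by rewrite map_inj_in_uniq ?enum_uniq // => u v; rewrite !mem_enum; apply: r_inj.
move: {2}(r x) (erefl (r x)) => k rx; rewrite rx.
elim: k x rx => // k IH x /r_cover[y yx yk].
by apply: leq_ltn_trans (IH y yk) (rank_lt yx).
Qed.

Section FaceVertices.
Context {R : realType} {m : nat} {I : finType} (v : I -> 'rV[R]_m).
Implicit Types F G : face v.

Lemma face_le_vertices F G : (F <= G)%O = (face_vertices F \subset face_vertices G).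
Proof.
apply/idP/fintype.subsetP => [/face_leE FG i|FG].
  by rewrite !inE; exact: FG.
apply/face_leE => x /faceP[l [l0 l1 xl lF]]; apply/faceP; exists l; split=> // i.
by move/lF/FG.
Qed.

Lemma face_vertices_inj : injective (@face_vertices R m I v).
Proof. exact: pcan_inj (face_verticesK (v := v)). Qed.

Lemma face_vertices0 : face_vertices (\bot%O : face v) = finset.set0.
Proof. by apply/setP => i; rewrite !inE; apply/asboolP. Qed.

Lemma face_vertices_eq0 F : (face_vertices F == finset.set0) = (F == \bot%O).
Proof. by rewrite -face_vertices0 (inj_eq face_vertices_inj). Qed.

Lemma mem_face_vertices F : exists (a : 'rV[R]_m) (b : R),
  (forall i, dot a (v i) <= b) /\
  forall i, (i \in face_vertices F) = (dot a (v i) == b).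
Proof.
have /asboolP[a [b [le_b FE]]] := valP F; exists a, b.
split=> i; first exact/le_b/conv_vertex.
rewrite inE FE; apply/asboolP/eqP => [[]//|ab]; split=> //.
exact: conv_vertex.
Qed.

Lemma face_of_functional (a : 'rV[R]_m) (b : R) : (forall i, dot a (v i) <= b) ->
  exists F, forall i, (i \in face_vertices F) = (dot a (v i) == b).
Proof.
move=> le_b.
have aF : `[< is_face (conv v) (conv v `&` [set x | dot a x = b])%classic >].
  apply/asboolP; exists a, b; split=> // x [l [l0 l1 ->]].
  rewrite dot_sum -[leRHS]mul1r -l1 mulr_suml; apply: ler_sum => i _.
  by rewrite ler_wpM2l.
exists (Face aF) => i; rewrite inE; apply/asboolP/eqP => [[]//|ab]; split=> //.
exact: conv_vertex.
Qed.

End FaceVertices.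

Section PermutahedronFaces.
Variables (R : realType) (N : nat).
Local Notation T := (face (@perm_vector R N)).
Implicit Types (F G : T) (L : seq {set 'I_N}).

Definition represents L F : bool :=
  [forall p, (p \in face_vertices F) == compatible (pos L) p].

Lemma representsP L F :
  reflect (forall p, (p \in face_vertices F) = compatible (pos L) p) (represents L F).
Proof. by apply: (iffP forallP) => h p; apply/eqP; rewrite h. Qed.

Lemma represented_exists F : F != \bot%O ->
  exists2 L, is_osp finset.setT L & represents L F.
Proof.
rewrite -face_vertices_eq0 => /set0Pn[p0 p0F].
have [a [b [le_b memF]]] := mem_face_vertices F.
(* Replaces the real coordinates by natural numbers below N with the same order, as [level_sets]
   requires. *)
pose lev i := #|[set j | a 0 j < a 0 i]%SET|.
have lev_mono i j : a 0 i < a 0 j -> (lev i < lev j)%N.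
  move=> ij; apply: proper_card; apply/properP; split.
    by apply/fintype.subsetP => k; rewrite !inE => /lt_trans; apply.
  by exists i; rewrite !inE ?ltxx.
have lev_lt i j : (lev i < lev j)%N = (a 0 i < a 0 j).
  have [/lev_mono//|/lev_mono|e] := ltgtP (a 0 i) (a 0 j).
    by move=> lt_ji; rewrite ltnNge ltnW.
  by rewrite /lev e ltnn.
have lev_bound i : (lev i < 0 + N)%N.
  rewrite add0n -[X in (_ < X)%N]card_ord -cardsT; apply: proper_card.
  by apply/properP; split; [exact: finset.subsetT | exists i; rewrite !inE ?ltxx].
have [] := level_setsP lev_bound.
set L := level_sets _ _ _; rewrite (_ : finset _ = finset.setT); last first.
  by apply/setP => i; rewrite !inE.
move=> ospL posL; exists L => //; apply/representsP => p.
have compE q : compatible (pos L) q = compatible (a 0) q.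
  by apply/compatibleP/compatibleP => h i j ij; apply: h; move: ij;
    rewrite ltEnat /= posL // lev_lt.
have [q cq] := compatible_exists (pos L); rewrite compE in cq *.
(* Because F has a vertex, the bound b is attained and equals the maximum, which compatible
   permutations reach. *)
have bE : b = dot a (perm_vector R q).
  apply/eqP; rewrite eq_le le_b andbT; move: p0F; rewrite memF => /eqP <-.
  exact: (dot_compatible p0 cq).1.
by rewrite memF bE (dot_compatible p cq).2.
Qed.

(** The functional whose coordinates are the block positions is maximal exactly at the permutations
    compatible with them. *)
Lemma face_of_osp L : is_osp finset.setT L -> exists F, represents L F.
Proof.
move=> ospL; have [q cq] := compatible_exists (pos L).
pose a : 'rV[R]_N := \row_i (pos L i)%:R.
have compE p : compatible (pos L) p = compatible (a 0) p.
  by apply/compatibleP/compatibleP => h i j ij; apply: h; move: ij;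
    rewrite ltEnat /= !mxE ltr_nat.
rewrite compE in cq.
have [|F memF] := @face_of_functional _ _ _ (@perm_vector R N) a (dot a (perm_vector R q)).
  by move=> p; exact: (dot_compatible p cq).1.
by exists F; apply/representsP => p; rewrite memF compE (dot_compatible p cq).2.
Qed.

Lemma represents_neq0 L F : represents L F -> F != \bot%O.
Proof.
move=> /representsP LF; have [p cp] := compatible_exists (pos L).
by rewrite -face_vertices_eq0; apply/set0Pn; exists p; rewrite LF.
Qed.

Lemma represents_le L L' F F' : is_osp finset.setT L -> is_osp finset.setT L' ->
  represents L F -> represents L' F' -> (F' <= F)%O = (L' \in refinements L).
Proof.
move=> ospL ospL' /representsP LF /representsP LF'.
rewrite face_le_vertices; apply/fintype.subsetP/idP => [sub|L'L p].
  apply: (mem_refinements ospL ospL') => i j _ _.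
  by apply: (compatible_sub _ _).1 => p; rewrite -LF -LF'; apply: sub.
rewrite LF LF'; apply: (compatible_sub _ _).2 => i j.
exact: (refinements_pos ospL L'L (finset.in_setT i) (finset.in_setT j)).
Qed.

Lemma represents_inj L L' F : is_osp finset.setT L -> is_osp finset.setT L' ->
  represents L F -> represents L' F -> L = L'.
Proof.
move=> ospL ospL' LF LF'.
have := represents_le ospL ospL' LF LF'; rewrite lexx => /esym.
have := represents_le ospL' ospL LF' LF; rewrite lexx => /esym.
move=> /(size_refinements ospL')/andP[le1 _] /(size_refinements ospL)/andP[le2].
by move=> /implyP eL; apply/eqP/eL; rewrite eqn_leq le1 le2.
Qed.

Definition blocks F : seq {set 'I_N} :=
  nth [::] (osp finset.setT) (find (represents^~ F) (osp finset.setT)).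

Lemma blocksP F : F != \bot%O ->
  is_osp finset.setT (blocks F) /\ represents (blocks F) F.
Proof.
move=> /represented_exists[L ospL LF].
have hL : has (represents^~ F) (osp finset.setT).
  by apply/hasP; exists L; rewrite ?mem_osp.
split; last exact: (nth_find [::] hL).
by rewrite -mem_osp mem_nth // -has_find.
Qed.

Lemma blocksE L F : is_osp finset.setT L -> represents L F -> blocks F = L.
Proof.
move=> ospL LF; have [ospF bF] := blocksP (represents_neq0 LF).
exact: represents_inj ospF ospL bF LF.
Qed.

Lemma blocks_le F G : F != \bot%O -> G != \bot%O ->
  (F <= G)%O = (blocks F \in refinements (blocks G)).
Proof.
by move=> /blocksP[oF rF] /blocksP[oG rG]; apply: represents_le.
Qed.

(** For a nonempty face this is one more than its dimension, N minus the number of blocks. *)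
Definition face_rank F : nat := if F == \bot%O then 0%N else (N.+1 - size (blocks F))%N.

Lemma size_blocks F : F != \bot%O -> (size (blocks F) <= N)%N.
Proof. by case/blocksP => /size_osp; rewrite cardsT card_ord. Qed.

Lemma face_rank_mono F G : (F < G)%O -> (face_rank F < face_rank G)%N.
Proof.
move=> FG; have G0 : G != \bot%O by rewrite -lt0x (le_lt_trans (le0x F)).
rewrite /face_rank (negPf G0); have sG := size_blocks G0.
have [F0|F0] := eqVneq F \bot%O; first by lia.
have [ospG rG] := blocksP G0; have [ospF rF] := blocksP F0.
move: FG; rewrite lt_neqAle blocks_le // => /andP[neFG FG].
have /andP[le_s /implyP eq_s] := size_refinements ospG FG.
have sF := size_blocks F0.
suff : (size (blocks G) != size (blocks F))%N by lia.
apply: contra neFG => /eq_s/eqP e; apply/eqP/le_anti.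
by rewrite !blocks_le // e (refinements_refl ospF).
Qed.

Lemma face_rank_cover F k : face_rank F = k.+1 ->
  exists2 G, (G < F)%O & face_rank G = k.
Proof.
rewrite /face_rank; have [//|F0] := eqVneq F \bot%O.
have [ospF rF] := blocksP F0; have sF := size_blocks F0 => e.
have [eN|neN] := eqVneq (size (blocks F)) N.
  by exists \bot%O; rewrite ?lt0x // eqxx; lia.
have [|L LF sL] := refinements_split ospF.
  by rewrite cardsT card_ord; lia.
have ospL := refinements_osp ospF LF; have [G rG] := face_of_osp ospL.
have G0 := represents_neq0 rG; have bG := blocksE ospL rG.
exists G; last by rewrite (negPf G0) bG sL; lia.
rewrite lt_neqAle blocks_le // bG LF andbT.
by apply/eqP => GF; move/eqP: sL; rewrite -bG GF ltn_eqF.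
Qed.

Lemma rankE F : rank F = face_rank F.
Proof. exact: rank_eq face_rank_mono face_rank_cover F. Qed.

Lemma osp_setT : (0 < N)%N -> is_osp finset.setT [:: finset.setT : {set 'I_N}].
Proof.
move=> N0; rewrite /= -card_gt0 cardsT card_ord N0 fintype.subxx.
by rewrite finset.setDv eqxx.
Qed.

Lemma top_neq_bot : (0 < N)%N -> \top%O != \bot%O :> T.
Proof.
move=> /osp_setT/face_of_osp[F rF]; apply: contraNneq (represents_neq0 rF) => e.
by rewrite -lex0 -e lex1.
Qed.

Lemma blocks_top : (0 < N)%N -> blocks \top%O = [:: finset.setT].
Proof.
move=> /osp_setT o1; have [F rF] := face_of_osp o1.
rewrite (_ : \top%O = F) ?(blocksE o1 rF) //.
apply/le_anti; rewrite lex1 andbT.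
rewrite face_le_vertices; apply/fintype.subsetP => p _.
move/representsP: rF => ->; apply/compatibleP => i j.
by rewrite /pos /= !inE.
Qed.

Lemma sum_faces_below (A : comNzRingType) (phi : seq {set 'I_N} -> A) F :
  F != \bot%O ->
  \sum_(G | (G <= F)%O && (G != \bot%O)) phi (blocks G) =
  \sum_(L <- refinements (blocks F)) phi L.
Proof.
move=> F0; have [ospF rF] := blocksP F0.
rewrite -big_filter -(big_map blocks predT phi) /=.
set s1 := [seq blocks G | G <- _].
rewrite (perm_big (refinements (blocks F))) //; apply: uniq_perm.
- rewrite map_inj_in_uniq ?filter_uniq ?index_enum_uniq // => G H.
  rewrite !mem_filter => /andP[/andP[_ G0] _] /andP[/andP[_ H0] _] e.
  have [oG _] := blocksP G0; apply/le_anti; rewrite !blocks_le // -e.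
  by rewrite (refinements_refl oG).
- exact: refinements_uniq.
- move=> L; apply/mapP/idP => [[G]|LF].
    by rewrite mem_filter => /andP[/andP[GF G0] _] ->; rewrite -blocks_le.
  have ospL := refinements_osp ospF LF; have [G rG] := face_of_osp ospL.
  have G0 := represents_neq0 rG; exists G; last by rewrite (blocksE ospL rG).
  by rewrite mem_filter G0 blocks_le // (blocksE ospL rG) LF mem_index_enum.
Qed.

End PermutahedronFaces.

(** * The toric g-polynomial of the permutahedron *)

(** [gtrunc m f] consists of the terms of (1 - X) f of degree at most m, so a congruence and a
    degree bound determine it. *)
Lemma gtrunc_eq m (f g : Kx) :
  (size g <= m.+1)%N -> Xdvd m.+1 (sX * f + g) -> gtrunc m f = g.
Proof.
move=> sg [q e]; apply/polyP => i; rewrite coef_poly.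
case: ltnP => [im|mi]; last by rewrite nth_default // (leq_trans sg).
have : (sX * f + g)`_i = 0 by rewrite e coefXnM im.
rewrite mulrBl mul1r coefD coefB coefXM; case: i {im} => [|i] /= ei; lra.
Qed.

Lemma homog_prod (A : comNzRingType) (u v : A) (h : nat -> A) (T : finType)
    (B : {set T}) (L : seq {set T}) :
  (forall b, homog u v b.-1 (h b)) -> is_osp B L ->
  homog u v (#|B| - size L) (\prod_(X <- L) h #|X|).
Proof.
move=> hh; elim: L B => [|X L IH] B /=.
  by move=> /eqP ->; rewrite cards0 big_nil; apply: homog1.
case/and3P=> X0 XB /[dup] /size_osp le /IH; rewrite big_cons => hL.
have -> : (#|B| - (size L).+1 = #|X|.-1 + (#|B :\: X| - size L))%N.
  move: le; rewrite cardsD (finset.setIidPr XB).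
  by move: X0 (fintype.subset_leq_card XB); rewrite -card_gt0; lia.
exact: homogM.
Qed.

Lemma sum_refinements_perm_h (T : finType) (B : {set T}) (L : seq {set T}) :
  is_osp B L ->
  \sum_(L' <- refinements L)
     (sX ^+ (size L' - size L))%:P * \prod_(X <- L') perm_h #|X| =
  \prod_(X <- L) perm_hsum #|X|.
Proof.
(* The extra power of sX provides one factor for each block of the refinement, and the sum then
   factors over the blocks of [L]. *)
move=> ospL; apply: (@mulfI _ (sX%:P ^+ size L)).
  by rewrite expf_eq0 polyC_eq0 polyXsubC_eq0 andbF.
have prodZ (h : nat -> {poly Kx}) (L' : seq {set T}) : \prod_(X <- L') (sX%:P * h #|X|) =
    sX%:P ^+ size L' * \prod_(X <- L') h #|X|.
  by rewrite big_split /= big_const_seq count_predT iter_mulr_1.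
rewrite -(prodZ perm_hsum) mulr_sumr.
rewrite [RHS](_ : _ = \prod_(X <- L) osp_sum (fun b => sX%:P * perm_h b) X).
  rewrite -prod_osp_sum big_seq [RHS]big_seq; apply: eq_bigr => L' LL'.
  have /andP[le _] := size_refinements ospL LL'.
  by rewrite prodZ mulrA rmorphXn -exprD subnKC.
rewrite big_seq [RHS]big_seq; apply: eq_bigr => X XL.
by rewrite osp_sum_perm_h // (osp_neq0 ospL XL).
Qed.

Section PermutahedronToric.
Variables (R : realType) (N : nat).
Local Notation T := (face (@perm_vector R N)).

(** A face is a product of permutahedra, one per block. By induction on the rank, [gtrunc_eq]
    reduces the claim to the degree bound for [toric_umbral] and the divisibility for
    [toric_umbral']. *)
Theorem toric_g_face (F : T) : F != \bot%O ->
  toric_g_at F = toric_umbral (\prod_(B <- blocks F) perm_h #|B|).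
Proof.
have [k] := ubnP (rank F); elim: k F => // k IH F Fk F0.
have [ospF rF] := blocksP F0; have sF := size_blocks F0.
set m := (N - size (blocks F))%N.
have rkF : rank F = m.+1 by rewrite rankE /face_rank (negPf F0) subSn.
have hdeg h u v : (forall b, homog u v b.-1 (h b)) ->
    homog u v m (\prod_(B <- blocks F) h #|B| : {poly Kx}).
  by move=> hh; have := homog_prod hh ospF; rewrite cardsT card_ord.
rewrite (toric_g_atE rkF); apply: gtrunc_eq.
  exact/size_toric_umbral/hdeg/homog_perm_h.
(* Adding the claimed g-polynomial of F completes the sum over proper nonempty faces to all nonempty
   ones; the empty face contributes sX^(m + 1), the correction term of [toric_umbral']. *)
suff -> : sX * toric_f_at F + toric_umbral (\prod_(B <- blocks F) perm_h #|B|) =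
    toric_umbral' (\prod_(B <- blocks F) perm_hsum #|B|).
  exact/Xdvd_toric_umbral'/hdeg/homog_perm_hsum.
rewrite (toric_f_atE rkF) (bigD1 \bot%O) /=; last by rewrite lt0x.
have rk0 : rank (\bot%O : T) = 0%N by rewrite rankE /face_rank eqxx.
rewrite toric_g_at0 // rk0 subn0 mul1r.
pose phi (L : seq {set 'I_N}) : Kx := toric_umbral
  ((sX ^+ (size L - size (blocks F)))%:P * \prod_(X <- L) perm_h #|X|).
have e : sX * \sum_(G : T | (G < F)%O && (G != \bot%O))
      toric_g_at G * sX ^+ (m - rank G) +
    toric_umbral (\prod_(B <- blocks F) perm_h #|B|) =
    \sum_(G : T | (G <= F)%O && (G != \bot%O)) phi (blocks G).
  rewrite [RHS](bigD1 F) /=; last by rewrite lexx.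
  rewrite addrC [phi (blocks F)]/phi subnn expr0 mul1r; congr (_ + _).
  rewrite mulr_sumr; apply: eq_big => G; first by rewrite lt_neqAle [RHS]andbC andbA.
  move=> /andP[GF G0]; have Gk : (rank G < k)%N.
    by apply: leq_trans (rank_lt GF) _; rewrite -ltnS.
  rewrite IH // /phi /toric_umbral umbralZ -/(toric_umbral _) mulrCA mulrC -exprS.
  congr (_ ^+ _ * _); have := rank_lt GF.
  by rewrite !rankE /face_rank (negPf G0) (negPf F0) /m; have := size_blocks G0; lia.
rewrite mulrDr -exprS -addrA e sum_faces_below // /phi /toric_umbral -umbral_sum.
rewrite (sum_refinements_perm_h ospF) /toric_umbral' addrC; congr (_ + _).
rewrite horner_prod exprS; congr (_ * _).
have -> : \prod_(B <- blocks F) (perm_hsum #|B|).[- sX] =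
    \prod_(B <- blocks F) sX ^+ #|B|.-1.
  rewrite big_seq [RHS]big_seq; apply: eq_bigr => B /(osp_neq0 ospF).
  by rewrite -card_gt0; case: #|B| => // b _; rewrite horner_perm_hsum.
rewrite prodrXr; congr (_ ^+ _).
by rewrite (sum_card_pred_osp ospF) cardsT card_ord.
Qed.

Theorem permutahedron_gE n : N = n.+1 -> toric_g T = toric_umbral (perm_h N).
Proof.
move=> eN; have N0 : (0 < N)%N by rewrite eN.
rewrite /toric_g toric_g_face; last exact: top_neq_bot.
by rewrite (blocks_top _ N0) big_seq1 cardsT card_ord.
Qed.

End PermutahedronToric.

(** * Enumeration of parking trees *)

Local Close Scope ring_scope.

Definition tree_biwords (n k : nat) : seq (seq (nat * nat)) :=
  [seq l <- biwords n n | (size l == n) && (weak_descents (unzip1 l) == k)].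

Lemma mem_tree_biwords n k l : (l \in tree_biwords n k) =
  [&& size l == n, edge_word (rev l), avoids321 (unzip1 l) &
      weak_descents (unzip1 l) == k].
Proof.
rewrite mem_filter mem_biwords // subnn -andbA; case: eqP => //= sl.
rewrite andbC andbA; congr (_ && _); rewrite /biword /edge_word size_rev sl all_rev.
rewrite andbA; congr (_ && _); case: allP => //= al.
rewrite /unzip2 map_rev perm_rev -/(unzip2 l).
apply/idP/idP => [ul|/perm_uniq ->]; last exact: iota_uniq.
(* Distinct labels in 2, ..., n + 1, being n in number, exhaust this range. *)
have [||s_eq m_eq] := @uniq_min_size _ (unzip2 l) (iota 2 n) ul.
- by move=> b /mapP[p /al/= h ->]; rewrite mem_iota; lia.
- by rewrite size_iota size_map sl.
exact: uniq_perm ul (iota_uniq _ _) m_eq.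
Qed.

Lemma tree_biwords_uniq n k : uniq (tree_biwords n k).
Proof. by rewrite filter_uniq // biwords_uniq. Qed.

Lemma coef_permutahedron_g (R : realType) n k :
  ((permutahedron_g R n)`_k = (size (tree_biwords n k))%:Z)%R.
Proof.
rewrite /permutahedron_g (permutahedron_gE R (erefl n.+1)) -sum_biwords.
rewrite coef_sum size_filter -sum1_count.
rewrite -[RHS]natz natr_sum big_mkcondr /=; apply: eq_bigr => l _.
by rewrite coefXn eq_sym; case: eqP.
Qed.

Theorem theorem9p3 (R : realType) (n k : nat) (hn : (1 <= n)%N) :
  exists N : nat,
    ([set t : ptree | parking_tree n t
        /\ parking_function n (encoded t)
        /\ avoids123 n (encoded t)
        /\ ascents n (encoded t) = k] #= `I_N)%card%classic /\
    ((permutahedron_g R n)`_k = N%:Z)%R.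
Proof.
exists (size (tree_biwords n k)); split; last exact: coef_permutahedron_g.
pose word t := rev (tree_word n t).
have wordP t : parking_tree n t -> (word t \in tree_biwords n k) =
    avoids321 (rev [seq encoded t i | i <- iota 1 n]) && (ascents n (encoded t) == k).
  move=> tP; rewrite mem_tree_biwords /word revK (edge_word_tree tP).
  rewrite size_rev size_map size_iota eqxx /unzip1 map_rev -/(unzip1 _).
  by rewrite unzip1_tree_word // ascentsE.
(* A tree is sent to the index of its reversed edge word in the duplicate-free list. *)
apply/card_set_bijP; exists (fun t => index (word t) (tree_biwords n k)); split.
- move=> t /= [tP [_ [/avoids123P av ak]]].
  by rewrite index_mem wordP // av ak eqxx.
- move=> t t'; rewrite !inE => -[tP [_ [/avoids123P av ak]]] [tP' [_ [/avoids123P av' ak']]] e.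
  have wt : word t \in tree_biwords n k by rewrite wordP // av ak eqxx.
  have wt' : word t' \in tree_biwords n k by rewrite wordP // av' ak' eqxx.
  have ww : word t = word t' by rewrite -(nth_index [::] wt) e nth_index.
  by rewrite -(word_tree_word tP) -(word_tree_word tP') -[tree_word n t]revK -/(word t) ww revK.
- move=> j /= jN; pose l := nth [::] (tree_biwords n k) j.
  have lP : l \in tree_biwords n k by rewrite mem_nth.
  have := lP; rewrite mem_tree_biwords => /and4P[/eqP sl ew av ak].
  have srl : size (rev l) = n by rewrite size_rev.
  have tw : tree_word n (word_tree (rev l)) = rev l by rewrite -{1}srl tree_word_build.
  have tP : parking_tree n (word_tree (rev l)).
    by have /andP[h1 h2] := ew; rewrite -[X in parking_tree X]srl; apply: build_parking_tree.
  have wl : word (word_tree (rev l)) = l by rewrite /word tw revK.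
  exists (word_tree (rev l)); last by rewrite wl index_uniq // tree_biwords_uniq.
  have := wordP _ tP; rewrite wl lP => /esym /andP[av' /eqP ak'].
  split=> //; split; first exact: parking_function_encoded.
  by split=> //; apply/avoids123P.
Qed.
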